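(* Let $(R,\mathfrak m)$ be a regular local ring with $\dim R\leq 3$ and let $I$ be an ideal of $R$. Then $\operatorname{astab}(I)=\operatorname{dstab}(I)$. The same holds for a graded ideal $I$ in a polynomial ring $R$ over a field in at most $3$ variables.
   Context: For an ideal $I$ of a Noetherian ring $R$: $\operatorname{astab}(I)$ is the smallest positive integer $k_0$ such that $\operatorname{Ass}(R/I^k)=\operatorname{Ass}(R/I^{k_0})$ for all $k\geq k_0$; $\operatorname{dstab}(I)$ is the smallest positive integer $k_0$ such that $\operatorname{depth} R/I^k=\operatorname{depth} R/I^{k_0}$ for all $k\geq k_0$ (in the graded case depth is taken with respect to the graded maximal ideal). *)

(* Defs.v *)
From HB Require Import structures.
From mathcomp Require Import all_boot all_order all_algebra.
From mathcomp Require Import mpoly.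
Set Implicit Arguments. Unset Strict Implicit. Unset Printing Implicit Defensive.
Import Order.TTheory GRing.Theory Num.Theory.
Local Open Scope ring_scope.

Section CommAlg.
Variable R : comNzRingType.

Definition is_ideal (I : R -> Prop) : Prop :=
  [/\ I 0, (forall x y, I x -> I y -> I (x + y)) & (forall r x, I x -> I (r * x))].

Definition same_set (I J : R -> Prop) : Prop := forall x, I x <-> J x.

Definition gen_ideal (S : R -> Prop) : R -> Prop :=
  fun x => exists l : seq (R * R),
    (forall p, p \in l -> S p.2) /\
    x = \sum_(p <- l) p.1 * p.2.

Definition span_seq (s : seq R) : R -> Prop := gen_ideal (fun x => x \in s).

Definition ideal_pow (I : R -> Prop) (k : nat) : R -> Prop :=
  gen_ideal (fun x => exists l : seq R,
    size l = k /\ (forall a, a \in l -> I a) /\ x = \prod_(a <- l) a).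

Definition ideal_add (I J : R -> Prop) : R -> Prop :=
  fun x => exists a b, I a /\ J b /\ x = a + b.

Definition is_prime_ideal (P : R -> Prop) : Prop :=
  [/\ is_ideal P, ~ P 1 & (forall x y, P (x * y) -> P x \/ P y)].

Definition is_maximal_ideal (M : R -> Prop) : Prop :=
  [/\ is_ideal M, ~ M 1 &
      (forall J, is_ideal J -> (forall x, M x -> J x) -> same_set J M \/ J 1)].

Definition noetherian : Prop :=
  forall I, is_ideal I -> exists s : seq R, same_set I (span_seq s).

Definition local_with (m : R -> Prop) : Prop :=
  is_maximal_ideal m /\ forall M, is_maximal_ideal M -> same_set M m.

Definition prime_chain (n : nat) (P : nat -> R -> Prop) : Prop :=
  (forall i, (i <= n)%N -> is_prime_ideal (P i)) /\
  (forall i, (i < n)%N ->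
     (forall x, P i x -> P i.+1 x) /\ exists x, P i.+1 x /\ ~ P i x).

Definition krull_dim_eq (d : nat) : Prop :=
  (exists P, prime_chain d P) /\ (forall n P, prime_chain n P -> (n <= d)%N).

Definition regular_local_dim (m : R -> Prop) (d : nat) : Prop :=
  [/\ noetherian, local_with m, krull_dim_eq d &
      exists s : seq R, size s = d /\ same_set m (span_seq s)].

Definition ass_quot (J : R -> Prop) (P : R -> Prop) : Prop :=
  is_prime_ideal P /\ exists x : R, same_set P (fun r => J (r * x)).

(* x = [:: x_1; ...; x_n] is an (R/J)-regular sequence in m:
   each x_i lies in m and is a nonzerodivisor on R/(J + (x_1,...,x_{i-1})).
   (M/(x)M = R/(J+(x)) for M = R/J.) *)
Definition quot_regular_seq (m : R -> Prop) (J : R -> Prop) (s : seq R) : Prop :=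
  forall i, (i < size s)%N ->
    m (nth 0 s i) /\
    forall r, ideal_add J (span_seq (take i s)) (nth 0 s i * r) ->
              ideal_add J (span_seq (take i s)) r.

(* depth_m (R/J) >= n: there is an (R/J)-regular sequence in m of length n.
   (With this convention the zero module R/R has infinite depth.) *)
Definition depth_ge (m : R -> Prop) (J : R -> Prop) (n : nat) : Prop :=
  exists s : seq R, size s = n /\ quot_regular_seq m J s.

Definition ass_stable_from (I : R -> Prop) (k0 : nat) : Prop :=
  forall k, (k0 <= k)%N -> forall P,
    ass_quot (ideal_pow I k) P <-> ass_quot (ideal_pow I k0) P.

Definition is_astab (I : R -> Prop) (k0 : nat) : Prop :=
  [/\ (0 < k0)%N, ass_stable_from I k0 &
      forall k1, (0 < k1)%N -> ass_stable_from I k1 -> (k0 <= k1)%N].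

(* dstab(I) = k0 (depth w.r.t. m; equality of depths, possibly infinite,
   expressed as equality of all the statements "depth >= n"). *)
Definition depth_stable_from (m I : R -> Prop) (k0 : nat) : Prop :=
  forall k, (k0 <= k)%N -> forall n,
    depth_ge m (ideal_pow I k) n <-> depth_ge m (ideal_pow I k0) n.

Definition is_dstab (m I : R -> Prop) (k0 : nat) : Prop :=
  [/\ (0 < k0)%N, depth_stable_from m I k0 &
      forall k1, (0 < k1)%N -> depth_stable_from m I k1 -> (k0 <= k1)%N].

End CommAlg.

Section Graded.
Variables (K : fieldType) (n : nat).

Definition hcomp (d : nat) (p : {mpoly K[n]}) : {mpoly K[n]} :=
  \sum_(m <- msupp p | mdeg m == d) p@_m *: 'X_[m].

Definition graded_ideal (I : {mpoly K[n]} -> Prop) : Prop :=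
  is_ideal I /\ forall p d, I p -> I (hcomp d p).

Definition graded_max : {mpoly K[n]} -> Prop :=
  span_seq [seq 'X_i | i <- enum 'I_n].
End Graded.

(* Main.v *)
(* Both parts are instances of one situation: a Noetherian domain with a prime m = (x, y, z) such that (0), (x) and (x, y) are prime, everything being read up to multipliers outside m; zeros among x, y, z account for smaller dimensions. By Krull's principal ideal theorem chains of primes below m have length at most 3. For an ideal I = (f_1, ..., f_n) the syzygies of f, once I meets (x) in xI, are free up to such multipliers: they are so modulo (x, y), where the quotient is a discrete valuation ring, and Nakayama lifts a basis to (x) and then to (0). The Hilbert-Burch argument then writes I = s J with J = (h_1, ..., h_n) of grade at least 2, and I^k = s^k J^k.

If some h_i lies outside m, then I is principal, and neither the associated primes nor the regular sequences depend on k. Otherwise a prime P strictly below m is associated to I^k exactly when it is associated to (s) or contains J, since such a P containing J is minimal over J; so only the membership of m in Ass(R/I^k) can depend on k. The depth of R/I^k is at most 1, and it is 0 exactly when m is associated to I^k. *)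
Require Import Defs.
From HB Require Import structures.
From mathcomp Require Import all_boot all_order all_algebra.
From mathcomp Require Import mpoly.
From mathcomp Require Import ring.
From Stdlib Require Import Classical ClassicalEpsilon.
Set Implicit Arguments. Unset Strict Implicit. Unset Printing Implicit Defensive.
Import GRing.Theory.
Local Open Scope ring_scope.

(** * Ideals, submodules and Nakayama's lemma *)

(** Multipliers outside m take the place of localization, so that the local ring and the polynomial
    ring share one argument; in both, the ideals concerned are saturated and multipliers can be
    cancelled at the end. The condition that I meets (x) in xI says that x is regular on R/I; in
    dimension three it bounds the projective dimension of R/I by two, which is why the syzygies are
    free. A general I need not satisfy it. The generators are therefore first divided by a power of
    x and then replaced by generators of the saturation by x; after the factorization, an entry
    outside (x) makes it possible to return to the original generators and keep grade two. Finally,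
    Ass and depth are compared for two arbitrary positive exponents, after which the equality of the
    two indices is formal. *)

Definition is_submod (R : comNzRingType) (V : lmodType R) (M : V -> Prop) :=
  [/\ M 0, (forall v w, M v -> M w -> M (v + w)) & (forall r v, M v -> M (r *: v))].

Definition noeth_module (R : comNzRingType) (V : lmodType R) :=
  forall M : V -> Prop, is_submod M -> exists s : seq V,
    (forall v, v \in s -> M v) /\
    forall M' : V -> Prop, is_submod M' -> (forall v, v \in s -> M' v) ->
    forall v, M v -> M' v.

Section Submodules.
Variables (R : comNzRingType) (V : lmodType R).
Implicit Types M : V -> Prop.

Lemma submod0 M : is_submod M -> M 0. Proof. by case. Qed.
Lemma submodD M v w : is_submod M -> M v -> M w -> M (v + w).
Proof. by case=> _ + _; apply. Qed.
Lemma submodZ M r v : is_submod M -> M v -> M (r *: v).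
Proof. by case=> _ _; apply. Qed.
Lemma submodN M v : is_submod M -> M v -> M (- v).
Proof. by move=> sM Mv; rewrite -scaleN1r; apply: submodZ. Qed.
Lemma submodB M v w : is_submod M -> M v -> M w -> M (v - w).
Proof. by move=> sM Mv Mw; apply: submodD => //; apply: submodN. Qed.

(** If no member of the family is maximal, choice yields a strictly increasing chain; the finitely
    many generators of its union already lie in one term. *)
Lemma noeth_maximal (T : Type) (A : T -> Prop) (L : T -> V -> Prop) t0 :
  noeth_module V -> A t0 -> (forall t, A t -> is_submod (L t)) ->
  exists2 t, A t & forall t', A t' -> (forall v, L t v -> L t' v) ->
                   forall v, L t' v -> L t v.
Proof.
move=> nV At0 sL; apply: NNPP => noMax.
have step (t : {t | A t}) :
    exists t' : {t | A t}, (forall v, L (sval t) v -> L (sval t') v) /\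
      exists v, L (sval t') v /\ ~ L (sval t) v.
  case: t => t At /=; apply: NNPP => no; apply: noMax; exists t => // t' At' sub v Lv.
  by apply: NNPP => nLv; apply: no; exists (exist _ t' At'); split=> //; exists v.
pose next t := proj1_sig (constructive_indefinite_description _ (step t)).
have nextP t : (forall v, L (sval t) v -> L (sval (next t)) v) /\
      exists v, L (sval (next t)) v /\ ~ L (sval t) v.
  by rewrite /next; case: constructive_indefinite_description.
pose c n := iter n next (exist _ t0 At0).
have cS n v : L (sval (c n)) v -> L (sval (c n.+1)) v by case: (nextP (c n)) => + _; apply.
have cle i j v : (i <= j)%N -> L (sval (c i)) v -> L (sval (c j)) v.
  by move=> /subnK <-; elim: (j - i)%N => // k IH /IH /cS.
have sc n : is_submod (L (sval (c n))) by apply: sL; case: (c n).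
have sU : is_submod (fun v => exists n, L (sval (c n)) v).
  split; first by exists 0%N; apply: submod0.
  - move=> v w [i Li] [j Lj]; exists (maxn i j).
    by apply: submodD => //; [apply: cle Li; rewrite leq_maxl|apply: cle Lj; rewrite leq_maxr].
  - by move=> r v [i Li]; exists i; apply: submodZ.
have [s [sU' gen]] := nV _ sU.
have [k sk] : exists k, forall v, v \in s -> L (sval (c k)) v.
  elim: s sU' {gen} => [|a s IH] sU'; first by exists 0%N.
  have [n1 h1] := sU' a (mem_head _ _).
  have [|n2 h2] := IH; first by move=> v vs; apply: sU'; rewrite in_cons vs orbT.
  exists (maxn n1 n2) => v; rewrite in_cons => /orP[/eqP->|vs].
    by apply: cle h1; rewrite leq_maxl.
  by apply: cle (h2 _ vs); rewrite leq_maxr.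
have [_ [v [Lv nLv]]] := nextP (c k).
by apply: nLv; apply: gen => //; exists k.+1.
Qed.

End Submodules.

Section Ideals.
Variable R : comNzRingType.
Implicit Types (I J P Q : R -> Prop).

Lemma idl0 I : is_ideal I -> I 0. Proof. by case. Qed.
Lemma idlD I x y : is_ideal I -> I x -> I y -> I (x + y).
Proof. by case=> _ + _; apply. Qed.
Lemma idlM I r x : is_ideal I -> I x -> I (r * x).
Proof. by case=> _ _; apply. Qed.
Lemma idlMr I r x : is_ideal I -> I x -> I (x * r).
Proof. by rewrite mulrC; apply: idlM. Qed.
Lemma idlN I x : is_ideal I -> I x -> I (- x).
Proof. by move=> iI Ix; rewrite -mulN1r; apply: idlM. Qed.
Lemma idlB I x y : is_ideal I -> I x -> I y -> I (x - y).
Proof. by move=> iI Ix Iy; apply: idlD => //; apply: idlN. Qed.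
Lemma idl_sum I (T : eqType) (s : seq T) (F : T -> R) :
  is_ideal I -> (forall t, t \in s -> I (F t)) -> I (\sum_(t <- s) F t).
Proof.
move=> iI h; rewrite big_seq; apply: (big_ind I) => //; first exact: idl0.
by move=> x y; apply: idlD.
Qed.

Lemma prime_idl P : is_prime_ideal P -> is_ideal P. Proof. by case. Qed.
Lemma primeM P x y : is_prime_ideal P -> ~ P x -> ~ P y -> ~ P (x * y).
Proof. by case=> _ _ h nx ny /h[]. Qed.
Lemma primeX P x n : is_prime_ideal P -> ~ P x -> ~ P (x ^+ n).
Proof.
move=> pP nx; elim: n => [|n IH]; first by rewrite expr0; case: pP.
by rewrite exprS; apply: primeM.
Qed.
Lemma prime1 P : is_prime_ideal P -> ~ P 1. Proof. by case. Qed.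

Lemma gen_ideal_idl (S : R -> Prop) : is_ideal (gen_ideal S).
Proof.
split; first by exists [::]; split=> //; rewrite big_nil.
- move=> x y [l [hl ->]] [l' [hl' ->]]; exists (l ++ l'); split; last by rewrite big_cat.
  by move=> p; rewrite mem_cat => /orP[/hl|/hl'].
- move=> r x [l [hl ->]]; exists [seq (r * p.1, p.2) | p <- l]; split.
    by move=> p /mapP[q /hl ? ->].
  by rewrite big_map mulr_sumr; apply: eq_bigr => p _; rewrite mulrA.
Qed.

Lemma gen_ideal_in (S : R -> Prop) x : S x -> gen_ideal S x.
Proof.
move=> Sx; exists [:: (1, x)]; split; last by rewrite big_seq1 mul1r.
by move=> p; rewrite inE => /eqP->.
Qed.

Lemma gen_ideal_sub (S J : R -> Prop) :
  is_ideal J -> (forall x, S x -> J x) -> forall x, gen_ideal S x -> J x.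
Proof. by move=> iJ SJ x [l [hl ->]]; apply: idl_sum => // p /hl/SJ; apply: idlM. Qed.

Lemma ideal_addP I J : is_ideal I -> is_ideal J -> is_ideal (ideal_add I J).
Proof.
move=> iI iJ; split.
- by exists 0, 0; rewrite addr0; split; [apply: idl0|split=> //; apply: idl0].
- move=> x y [a [b [Ia [Jb ->]]]] [c [d [Ic [Jd ->]]]]; exists (a + c), (b + d).
  by split; [apply: idlD|split; [apply: idlD|ring]].
- move=> r x [a [b [Ia [Jb ->]]]]; exists (r * a), (r * b).
  by split; [apply: idlM|split; [apply: idlM|ring]].
Qed.

(** The ideal J + (a). *)
Definition add1 (J : R -> Prop) (a : R) : R -> Prop := fun x => exists r, J (x - r * a).

Lemma add1_idl J a : is_ideal J -> is_ideal (add1 J a).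
Proof.
move=> iJ; split.
- by exists 0; rewrite mul0r subr0; apply: idl0.
- move=> x y [r h] [r' h']; exists (r + r').
  have -> : x + y - (r + r') * a = (x - r * a) + (y - r' * a) by ring.
  exact: idlD.
- move=> c x [r h]; exists (c * r).
  have -> : c * x - c * r * a = c * (x - r * a) by ring.
  exact: idlM.
Qed.

Lemma add1_sub J a x : J x -> add1 J a x.
Proof. by exists 0; rewrite mul0r subr0. Qed.

Lemma add1_in J a : is_ideal J -> add1 J a a.
Proof. by move=> iJ; exists 1; rewrite mul1r subrr; apply: idl0. Qed.

Lemma add1_min I J a : is_ideal I -> (forall x, J x -> I x) -> I a ->
  forall x, add1 J a x -> I x.
Proof.
move=> iI JI Ia x [r /JI h].
have -> : x = (x - r * a) + r * a by ring.
by apply: idlD => //; apply: idlM.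
Qed.

Definition princ (a : R) : R -> Prop := fun x => exists r, x = r * a.

Lemma princ_idl a : is_ideal (princ a).
Proof.
split; first by exists 0; rewrite mul0r.
- by move=> x y [r ->] [r' ->]; exists (r + r'); rewrite mulrDl.
- by move=> c x [r ->]; exists (c * r); rewrite mulrA.
Qed.

Definition colon (Q : R -> Prop) (y : R) : R -> Prop := fun r => Q (r * y).

Lemma colon_idl Q y : is_ideal Q -> is_ideal (colon Q y).
Proof.
move=> iQ; split; first by rewrite /colon mul0r; apply: idl0.
- by move=> a b; rewrite /colon mulrDl; apply: idlD.
- by move=> r a; rewrite /colon -mulrA; apply: idlM.
Qed.

Lemma noeth_fg I : noetherian R -> is_ideal I ->
  exists s : seq R, (forall a, a \in s -> I a) /\
    forall J, is_ideal J -> (forall a, a \in s -> J a) -> forall x, I x -> J x.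
Proof.
move=> nR iI; have [s hs] := nR _ iI; exists s; split.
  by move=> a as_; apply/hs/gen_ideal_in.
by move=> J iJ sJ x /hs; apply: gen_ideal_sub.
Qed.

Lemma noeth_reg : noetherian R -> noeth_module R^o.
Proof. by move=> nR M sM; apply: (noeth_fg nR). Qed.

(** Finitely many elements generate [Q]; the product of their multipliers serves all of [Q]. *)
Lemma common_mult P Q T : noetherian R -> is_prime_ideal P -> is_ideal Q -> is_ideal T ->
  (forall r, Q r -> exists u, ~ P u /\ T (u * r)) ->
  exists u, ~ P u /\ forall r, Q r -> T (u * r).
Proof.
move=> nR pP iQ iT h.
have [s [sQ gen]] := noeth_fg nR iQ.
have [u [nu hu]] : exists u, ~ P u /\ forall a, a \in s -> T (u * a).
  elim: s sQ {gen} => [|a s IH] sQ; first by exists 1; split; first exact: prime1.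
  have [u [nu Tu]] := h a (sQ _ (mem_head _ _)).
  have [|w [nw Tw]] := IH; first by move=> b bs; apply: sQ; rewrite in_cons bs orbT.
  exists (u * w); split; first exact: primeM.
  move=> b; rewrite in_cons => /orP[/eqP->|/Tw bs].
    by rewrite mulrAC; apply: idlMr.
  by rewrite -mulrA; apply: idlM.
exists u; split=> // r Qr; rewrite mulrC.
by apply: (gen (colon T u)) Qr; [apply: colon_idl|move=> a /hu; rewrite /colon mulrC].
Qed.

(* Among the annihilators (Q : y) contained in P, a maximal one is prime. *)
Lemma ass_below P Q : noetherian R -> is_prime_ideal P -> is_ideal Q ->
  (forall x, Q x -> P x) ->
  exists y, is_prime_ideal (colon Q y) /\ forall x, colon Q y x -> P x.
Proof.
move=> nR pP iQ QP.
have [||y QyP maxy] := @noeth_maximal R R^o R (fun y => forall x, colon Q y x -> P x)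
   (colon Q) 1 (noeth_reg nR).
- by move=> x; rewrite /colon mulr1; apply: QP.
- by move=> t _; apply: colon_idl.
exists y; split=> //; split; first exact: colon_idl.
  by move=> /QyP; apply: prime1.
move=> a b Qab; have [|na] := classic (colon Q y a); [by left|right].
have [h|] := classic (forall x, colon Q (a * y) x -> P x).
  apply: (maxy _ h); first by move=> v; rewrite /colon mulrCA; apply: idlM.
  by move: Qab; rewrite /colon mulrA [b * a]mulrC.
move=> /not_all_ex_not[u hu]; have [Qu nPu] := imply_to_and _ _ hu; case: na.
apply: (maxy (u * y)).
- move=> x; rewrite /colon mulrA => /QyP; have [_ _ + h] := pP.
  by case/(_ _ _ h).
- by move=> v; rewrite /colon mulrCA; apply: idlM.
- by move: Qu; rewrite /colon mulrCA.
Qed.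

End Ideals.

(** [M] is a mere set of vectors, so the proof does not use generators of it. Among the v violating
    the conclusion it takes one with N + Rv maximal up to multipliers. The associated v' is also
    bad, so by maximality w v' = c v modulo N for some w outside P; then [u * w - c * x], which is
    outside P, carries v' into N. *)
Lemma nakayama (R : comNzRingType) (V : lmodType R) (P : R -> Prop) x
    (N M : V -> Prop) :
  noeth_module V -> is_prime_ideal P -> P x -> is_submod N ->
  (forall v, M v -> exists u v', [/\ ~ P u, M v' & N (u *: v - x *: v')]) ->
  forall v, M v -> exists u, ~ P u /\ N (u *: v).
Proof.
move=> nV pP Px sN h v0 Mv0; apply: NNPP => bad0.
pose bad v := M v /\ ~ exists u, ~ P u /\ N (u *: v).
pose L (v t : V) := exists u c, ~ P u /\ N (u *: t - c *: v).
have sL v : bad v -> is_submod (L v).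
  move=> _; split.
  - by exists 1, 0; rewrite scaler0 scale0r subr0; split; [apply: prime1|apply: submod0].
  - move=> t t' [u [c [nu Nu]]] [u' [c' [nu' Nu']]].
    exists (u * u'), (u' * c + u * c'); split; first exact: primeM.
    have -> : (u * u') *: (t + t') - (u' * c + u * c') *: v =
      u' *: (u *: t - c *: v) + u *: (u' *: t' - c' *: v).
      by rewrite scalerDr scalerDl !scalerBr !scalerA [u' * u]mulrC opprD addrACA.
    by apply: submodD => //; apply: submodZ.
  - move=> r t [u [c [nu Nu]]]; exists u, (r * c); split=> //.
    have -> : u *: (r *: t) - (r * c) *: v = r *: (u *: t - c *: v).
      by rewrite scalerBr !scalerA [u * r]mulrC.
    exact: submodZ.
have [v [Mv bv] maxv] := noeth_maximal nV (conj Mv0 bad0 : bad v0) sL.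
have [u [v' [nu Mv' Nv]]] := h _ Mv.
have bv' : bad v'.
  split=> // -[w [nw Nw]]; apply: bv; exists (w * u); split; first exact: primeM.
  have -> : (w * u) *: v = w *: (u *: v - x *: v') + x *: (w *: v').
    by rewrite scalerBr !scalerA [x * w]mulrC subrK.
  by apply: submodD => //; apply: submodZ.
have /(maxv _ bv') : forall t, L v t -> L v' t.
  move=> t [w [c [nw Nw]]]; exists (u * w), (c * x); split; first exact: primeM.
  have -> : (u * w) *: t - (c * x) *: v' =
     u *: (w *: t - c *: v) + c *: (u *: v - x *: v').
    by rewrite !scalerBr !scalerA [c * u]mulrC addrA subrK.
  by apply: submodD => //; apply: submodZ.
case/(_ v'); first by exists 1, 1; rewrite subrr; split; [apply: prime1|apply: submod0].
move=> w [c [nw Nw]]; apply: (proj2 bv'); exists (u * w - c * x); split.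
  move=> Pw; apply: (primeM pP nu nw).
  have -> : u * w = (u * w - c * x) + c * x by ring.
  by apply: idlD; [case: pP|done|apply: idlM => //; case: pP].
have -> : (u * w - c * x) *: v' = u *: (w *: v' - c *: v) + c *: (u *: v - x *: v').
  by rewrite scalerBl !scalerBr !scalerA [c * u]mulrC addrA subrK.
by apply: submodD => //; apply: submodZ.
Qed.

Lemma nakayama_ideal (R : comNzRingType) (P : R -> Prop) x (N M : R -> Prop) :
  noetherian R -> is_prime_ideal P -> P x -> is_ideal N ->
  (forall v, M v -> exists u v', [/\ ~ P u, M v' & N (u * v - x * v')]) ->
  forall v, M v -> exists u, ~ P u /\ N (u * v).
Proof. by move=> nR; apply: (@nakayama R R^o); apply: noeth_reg. Qed.

(** * Krull's principal ideal theorem and regular flags of primes *)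

Section Dimension.
Variable R : comNzRingType.
Hypothesis noethR : noetherian R.
Implicit Types (I J P Q : R -> Prop).

(** Ideals of the localization at [P] are represented by their contractions to R, which are the
    saturated ideals; [saturation] is extension followed by contraction. *)
Definition saturated P I := forall u r, ~ P u -> I (u * r) -> I r.
Definition saturation P I : R -> Prop := fun r => exists u, ~ P u /\ I (u * r).

Lemma saturation_idl P I : is_prime_ideal P -> is_ideal I -> is_ideal (saturation P I).
Proof.
move=> pP iI; split.
- by exists 1; rewrite mulr0; split; [apply: prime1|apply: idl0].
- move=> a b [u [nu Iu]] [v [nv Iv]]; exists (u * v); split; first exact: primeM.
  have -> : u * v * (a + b) = v * (u * a) + u * (v * b) by ring.
  by apply: idlD => //; apply: idlM.
- move=> r a [u [nu Iu]]; exists u; split=> //.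
  by rewrite mulrCA; apply: idlM.
Qed.

Lemma saturation_saturated P I : is_prime_ideal P -> saturated P (saturation P I).
Proof.
move=> pP u r nu [v [nv Iv]]; exists (v * u); split; first exact: primeM.
by rewrite -mulrA.
Qed.

Lemma saturation_sub P I x : is_prime_ideal P -> I x -> saturation P I x.
Proof. by exists 1; rewrite mul1r; split=> //; apply: prime1. Qed.

Lemma saturation_min P I J : saturated P J -> (forall x, I x -> J x) ->
  forall x, saturation P I x -> J x.
Proof. by move=> sJ IJ x [u [nu /IJ]]; apply: sJ. Qed.

(* R_P / Q is Artinian when P is the only prime between Q and P. *)
Lemma dcc_above P Q (D : nat -> R -> Prop) :
  is_prime_ideal P -> is_ideal Q -> (forall x, Q x -> P x) ->
  (forall P', is_prime_ideal P' -> (forall x, Q x -> P' x) ->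
     (forall x, P' x -> P x) -> forall x, P x -> P' x) ->
  (forall n, [/\ is_ideal (D n), saturated P (D n), (forall x, Q x -> D n x) &
                 forall x, D n.+1 x -> D n x]) ->
  exists n, forall x, D n x -> D n.+1 x.
Proof.
move=> pP iQ QP minP hD; apply: NNPP => noD.
(* Noetherian induction: [I] will be maximal among the saturated ideals containing Q above which
   some descending chain of saturated ideals never stabilizes. *)
pose badchain I (E : nat -> R -> Prop) :=
  (forall n, [/\ is_ideal (E n), saturated P (E n), (forall x, I x -> E n x) &
                 forall x, E n.+1 x -> E n x]) /\
  ~ exists n, forall x, E n x -> E n.+1 x.
pose A I := [/\ is_ideal I, saturated P I, (forall x, Q x -> I x) &
                exists E, badchain I E].
have [||I [iI sI QI [E [hE nE]]] maxI] := @noeth_maximal R R^o _ A id (saturation P Q)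
    (noeth_reg noethR).
- split; [exact: saturation_idl|exact: saturation_saturated|by move=> x; apply: saturation_sub|].
  exists D; split=> // n; have [iD sD QD dD] := hD n; split=> //.
  exact: saturation_min.
- by move=> I [].
have nI1 : ~ I 1.
  move=> I1; apply: nE; exists 0%N => x _; have [i _ IE _] := hE 1%N.
  by rewrite -[x]mulr1; apply: idlM => //; apply: IE.
have IP x : I x -> P x.
  by move=> Ix; apply: NNPP => nx; apply: nI1; apply: (sI x) => //; rewrite mulr1.
(* By minimality of P the prime [colon I y] is P, so I + (y) is locally a simple step above I. By
   maximality no bad chain lies above it; hence the chain E eventually misses y, and the chain
   obtained by adding y to its later terms stabilizes. *)
have [y [py yP]] := ass_below noethR pP iI IP.
have Py c : P c -> I (c * y).
  by apply: (minP _ py) => // x /QI; rewrite /colon mulrC; apply: idlM.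
have nIy : ~ I y by have [_ + _] := py; rewrite /colon mul1r.
pose J := saturation P (add1 I y).
have Jy : J y by apply: saturation_sub => //; apply: add1_in.
have noA : ~ A J.
  move=> AJ; apply: nIy; apply: (maxI J) => // x Ix.
  by apply: saturation_sub => //; apply: add1_sub.
have iJ : is_ideal J by apply: saturation_idl => //; apply: add1_idl.
have sJ : saturated P J by apply: saturation_saturated.
have QJ x : Q x -> J x.
  by move=> Qx; apply: saturation_sub => //; apply: add1_sub; apply: QI.
have [n0 nEy] : exists n0, ~ E n0 y.
  apply: NNPP => all; apply: noA; split=> //; exists E; split=> // n.
  have [i s IE d] := hE n; split=> //; apply: saturation_min => //.
  by apply: add1_min => //; apply: NNPP => nEn; apply: all; exists n.
apply: noA; split=> //; exists (fun n => saturation P (add1 (E (n0 + n)%N) y)).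
split.
  move=> n; have [i s IE _] := hE (n0 + n)%N; have [_ _ _ d] := hE (n0 + n)%N.
  split.
  - by apply: saturation_idl => //; apply: add1_idl.
  - exact: saturation_saturated.
  - move=> x [u [nu [r Ir]]]; exists u; split=> //; exists r; exact: IE.
  - by move=> x [u [nu [r Er]]]; exists u; split=> //; exists r; apply: d; rewrite -addnS.
move=> [n hn]; apply: nE; exists (n0 + n)%N => d Ed.
have [i s IE _] := hE (n0 + n)%N.
have [i1 s1 IE1 sub1] := hE (n0 + n).+1.
have [_ _ _ sub] := hE (n0 + n)%N.
have [|v [nv [c Ec]]] := hn d.
  by apply: saturation_sub => //; apply: add1_sub.
rewrite addnS in Ec.
(* Either c y lies in I, and d drops to the next term, or c is a unit at P and y would lie in a term
   that misses it. *)
have [Pc|nPc] := classic (P c).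
  apply: (s1 v) => //; have -> : v * d = (v * d - c * y) + c * y by ring.
  by apply: idlD => //; apply: IE1; apply: Py.
case: nEy.
have : E (n0 + n)%N y.
  apply: (s c) => //; have -> : c * y = v * d - (v * d - c * y) by ring.
  by apply: idlB => //; [apply: idlM|apply: sub].
elim: {hn d Ed i s IE i1 s1 IE1 sub1 sub Ec} n => [|n IH]; first by rewrite addn0.
by rewrite addnS; have [_ _ _ s] := hE (n0 + n)%N; move=> /s.
Qed.

(* Krull's principal ideal theorem, through E n = (P0 + (y^n) : x^oo) localized at P. *)
Lemma krull_pit P0 P1 P x :
  is_prime_ideal P0 -> is_prime_ideal P1 -> is_prime_ideal P ->
  (forall r, P0 r -> P1 r) -> (forall r, P1 r -> P r) ->
  (exists y, P1 y /\ ~ P0 y) -> P x -> ~ P1 x ->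
  exists P', [/\ is_prime_ideal P', (forall r, P0 r -> P' r), P' x,
                 (forall r, P' r -> P r) & exists r, P r /\ ~ P' r].
Proof.
move=> p0 p1 pP P01 P1P [y [P1y nP0y]] Px nP1x; apply: NNPP => noP'.
have i0 := prime_idl p0.
pose E n (r : R) := exists u i, ~ P u /\ add1 P0 (y ^+ n) (u * x ^+ i * r).
have iE n : is_ideal (E n).
  have ia : is_ideal (add1 P0 (y ^+ n)) by apply: add1_idl.
  split.
  - exists 1, 0%N; split; first exact: prime1.
    by rewrite mulr0; apply: idl0.
  - move=> a b [u [i [nu h]]] [v [j [nv k]]]; exists (u * v), (i + j)%N.
    split; first exact: primeM.
    have -> : u * v * x ^+ (i + j) * (a + b) = (v * x ^+ j) * (u * x ^+ i * a) +
       (u * x ^+ i) * (v * x ^+ j * b) by rewrite exprD; ring.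
    by apply: idlD => //; apply: idlM.
  - move=> r a [u [i [nu h]]]; exists u, i; split=> //.
    by rewrite mulrCA; apply: idlM.
have sE n : saturated P (E n).
  move=> u r nu [v [i [nv h]]]; exists (v * u), i; split; first exact: primeM.
  have -> : v * u * x ^+ i * r = v * x ^+ i * (u * r) by ring.
  by [].
have Ex n r : E n (r * x) -> E n r.
  move=> [v [i [nv h]]]; exists v, i.+1; split=> //.
  have -> : v * x ^+ i.+1 * r = v * x ^+ i * (r * x) by rewrite exprS; ring.
  by [].
have dE n r : E n.+1 r -> E n r.
  move=> [v [i [nv [c h]]]]; exists v, i; split=> //; exists (c * y).
  by rewrite -[c * y * _]mulrA -exprS.
(* Without the desired prime, P is minimal over P0 + (x), so the ideals E n + (x) stabilize
   locally. *)
have [||||n hn] := @dcc_above P (add1 P0 x) (fun n => saturation P (add1 (E n) x)) pP.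
- exact: add1_idl.
- by apply: add1_min => //; [apply: prime_idl|move=> r /P01/P1P].
- move=> P' p' sub subP r Pr; apply: NNPP => nr; apply: noP'; exists P'; split=> //.
  + by move=> s P0s; apply: sub; apply: add1_sub.
  + by apply: sub; apply: add1_in.
  + by exists r.
- move=> n; split.
  + by apply: saturation_idl => //; apply: add1_idl.
  + exact: saturation_saturated.
  + move=> r ar; apply: saturation_sub => //; move: r ar; apply: add1_min.
    * exact: add1_idl.
    * move=> s P0s; apply: add1_sub; exists 1, 0%N; split; first exact: prime1.
      by rewrite expr0 !mul1r; apply: add1_sub.
    * exact: add1_in.
  + by move=> r [u [nu [c h]]]; exists u; split=> //; exists c; apply: dE.
(* E n lies in E (n+1) + (x), and E n is closed under division by x, so the coefficient of x is
   again in E n; Nakayama puts y^n into E (n+1). *)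
have [] := @nakayama_ideal _ P x (E n.+1) (E n) noethR pP Px (iE _) _ (y ^+ n).
- move=> r Er; have [|u [nu [c h]]] := hn r.
    by apply: saturation_sub => //; apply: add1_sub.
  exists u, c; split=> //; last by rewrite [x * c]mulrC.
  apply: Ex; have -> : c * x = u * r - (u * r - c * x) by ring.
  by apply: idlB => //; [apply: idlM|apply: dE].
- exists 1, 0%N; split; first exact: prime1.
  by rewrite expr0 !mul1r; apply: add1_in.
move=> u [nu [v [i [nv [c h]]]]].
(* Cancelling y^n, which is outside P0, leaves v u x^i in P0 + (y), hence in P1, although none of v,
   u, x is in P1. *)
have : P0 (y ^+ n * (v * u * x ^+ i - c * y)).
  suff -> : y ^+ n * (v * u * x ^+ i - c * y) =
     v * x ^+ i * (u * y ^+ n) - c * y ^+ n.+1 by [].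
  by rewrite exprS; ring.
have [_ _ pM] := p0; case/pM; first exact: primeX.
move=> /P01 h1; have : P1 (v * u * x ^+ i).
  have -> : v * u * x ^+ i = (v * u * x ^+ i - c * y) + c * y by ring.
  by apply: idlD; [apply: prime_idl|done|apply: idlM => //; apply: prime_idl].
apply: (primeM p1); last exact: primeX.
by apply: (primeM p1); move=> /P1P.
Qed.

Lemma chain_le n (C : nat -> R -> Prop) i j x :
  prime_chain n C -> (i <= j)%N -> (j <= n)%N -> C i x -> C j x.
Proof.
move=> [_ h] /subnK <-; elim: (j - i)%N => // k IH le Cx.
by have [+ _] := h (k + i)%N le; apply; apply: IH => //; apply: ltnW.
Qed.

Lemma chain_prefix n k (C : nat -> R -> Prop) :
  (k <= n)%N -> prime_chain n C -> prime_chain k C.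
Proof.
move=> le [h1 h2]; split=> i ik; first by apply: h1; apply: leq_trans le.
by apply: h2; apply: leq_trans le.
Qed.

Lemma chain_append n (C : nat -> R -> Prop) P :
  prime_chain n C -> is_prime_ideal P -> (forall x, C n x -> P x) ->
  (exists x, P x /\ ~ C n x) ->
  prime_chain n.+1 (fun i => if (i <= n)%N then C i else P).
Proof.
move=> [h1 h2] pP sub ex; split=> i ile.
  by case: ifP => // /h1.
rewrite ltnS in ile; rewrite ile; case: ifP => [/h2//|].
by move=> /negbT; rewrite -leqNgt => ni; have -> : i = n by apply/eqP; rewrite eqn_leq ile.
Qed.

Lemma chain_push n (C : nat -> R -> Prop) x :
  prime_chain n.+1 C -> C n.+1 x ->
  exists C', [/\ prime_chain n C', (forall r, C' n r <-> C n.+1 r), C' 0%N x &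
                 forall r, C 0%N r -> C' 0%N r].
Proof.
elim: n C => [|n IH] C hC Cx.
  exists (fun _ => C 1%N); split=> //.
    by split=> // i _; case: hC => + _; apply.
  by move=> r; apply: (chain_le hC).
have [h1 h2] := hC.
have [P [pP CP PC Px [e [Ce nPe]]]] : exists P, [/\ is_prime_ideal P,
    (forall r, C n r -> P r) /\ (exists r, P r /\ ~ C n r),
    (forall r, P r -> C n.+2 r), P x & exists r, C n.+2 r /\ ~ P r].
  have [s1 e1] := h2 n.+1 (ltnSn _); have [s0 e0] := h2 n (leqW (ltnSn _)).
  have [C1x|nC1x] := classic (C n.+1 x).
    by exists (C n.+1); split=> //; apply: h1.
  have [|||P [pP s Px sP e]] := @krull_pit (C n) (C n.+1) (C n.+2) x _ _ _ s0 s1 e0 Cx nC1x.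
  - by apply: h1; rewrite ltnW.
  - exact: h1.
  - exact: h1.
  exists P; split=> //; split=> //; exists x; split=> //.
  by move=> /s0.
have [] := IH (fun i => if (i <= n)%N then C i else P).
- by apply: chain_append => //; [apply: chain_prefix hC; rewrite ltnW|case: CP|case: CP].
- by rewrite ltnn.
rewrite ltnn => C' [hC' top C'x sub].
exists (fun i => if (i <= n)%N then C' i else C n.+2); split=> //.
- apply: chain_append => //; first exact: h1.
    by move=> r /top /PC.
  by exists e; split=> // /top.
- by rewrite ltnn.
Qed.

(** Says that m = J + (xs), with the inclusion of m tested on all ideals containing J and [xs]. *)
Definition generates (m J : R -> Prop) (xs : seq R) :=
  [/\ (forall x, J x -> m x), (forall x, x \in xs -> m x) &
      forall I, is_ideal I -> (forall x, J x -> I x) ->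
        (forall x, x \in xs -> I x) -> forall x, m x -> I x].

Lemma generates_add1 m J a xs ys : is_ideal m -> is_ideal J ->
  perm_eq xs (a :: ys) -> generates m J xs -> generates m (add1 J a) ys.
Proof.
move=> im iJ pe [h1 h2 h3]; split.
- by apply: add1_min => //; apply: h2; rewrite (perm_mem pe) mem_head.
- by move=> x xs_; apply: h2; rewrite (perm_mem pe) in_cons xs_ orbT.
- move=> I iI sub1 sub2; apply: h3 => //.
    by move=> x Jx; apply: sub1; apply: add1_sub.
  move=> x; rewrite (perm_mem pe) in_cons => /orP[/eqP->|]; last exact: sub2.
  by apply: sub1; apply: add1_in.
Qed.

(** Each generator is moved into the bottom prime at the cost of one step of the chain; once none is
    left, m = J lies in the bottom prime and no step remains. *)
Lemma height_le m J xs n (C : nat -> R -> Prop) :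
  is_ideal m -> is_ideal J -> generates m J xs -> prime_chain n C ->
  (forall x, J x -> C 0%N x) -> (forall x, C n x <-> m x) -> (n <= size xs)%N.
Proof.
move=> im; elim: xs J n C => [|a xs IH] J [//|n] C iJ gen hC JC top.
  have [h1 h2] := hC; have [_ [e [C1e nC0e]]] := h2 0%N (ltn0Sn _).
  case: nC0e; have [_ _ h] := gen; apply: (h (C 0%N)) => //.
    by apply: prime_idl; apply: h1.
  by apply/top; apply: (chain_le hC) C1e.
have [|C' [hC' top' C'a sub]] := chain_push (x := a) hC.
  by apply/top; case: gen => _ + _; apply; rewrite mem_head.
apply: (IH (add1 J a) n C') => //.
- exact: add1_idl.
- exact: (generates_add1 _ _ _ gen).
- apply: add1_min => //; last by move=> x /JC/sub.
  by apply: prime_idl; case: hC' => + _; apply.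
- by move=> x; rewrite top'.
Qed.

Fixpoint prime_flag (J : R -> Prop) (ys : seq R) : Prop :=
  is_prime_ideal J /\ if ys is y :: ys' then prime_flag (add1 J y) ys' else True.

Lemma prime_ext P Q : (forall x, P x <-> Q x) -> is_prime_ideal P -> is_prime_ideal Q.
Proof.
move=> e [[h1 h2 h3] h4 h5]; split; last 1 first.
- by move=> x y /e/h5[/e|/e]; [left|right].
- split; first exact/e.
  + by move=> x y /e hx /e hy; apply/e; apply: h2.
  + by move=> r x /e hx; apply/e; apply: h3.
- by move=> /e.
Qed.

(** This is the theorem that a regular local ring is a domain, together with its quotients by a
    regular system of parameters. For a generator a outside C 0, induction puts C 0 inside J + (a).
    An element of C 0 is then r a modulo J, with r in C 0 because a is not, and Nakayama gives C 0 =
    J. *)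
Lemma regular_flag m J xs (C : nat -> R -> Prop) :
  is_prime_ideal m -> (forall I, is_ideal I -> saturated m I) ->
  is_ideal J -> generates m J xs -> prime_chain (size xs) C ->
  (forall x, J x -> C 0%N x) -> (forall x, C (size xs) x <-> m x) ->
  (forall x, C 0%N x -> J x) /\
  exists ys, [/\ size ys = size xs, generates m J ys & prime_flag J ys].
Proof.
move=> pm loc; have im := prime_idl pm.
move: {2}(size xs) (erefl (size xs)) => d.
elim: d xs J C => [|d IH] xs J C szxs iJ gen hC JC top.
  have CJ x : C 0%N x -> J x.
    move: top; rewrite szxs => top /top; have [_ _] := gen; apply=> //.
    by move: szxs => /eqP; rewrite size_eq0 => /eqP ->.
  split=> //; exists xs; split=> //.
  move: szxs => /eqP; rewrite size_eq0 => /eqP -> /=; split=> //.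
  apply: (@prime_ext (C 0%N)); first by move=> x; split; [apply: CJ|apply: JC].
  by case: hC => + _; apply.
have p0 : is_prime_ideal (C 0%N) by case: hC => + _; apply.
have [a axs nCa] : exists2 a, a \in xs & ~ C 0%N a.
  apply: NNPP => no; have [h1 h2] := hC.
  have [_ [e [C1e nC0e]]] := h2 0%N (leq_ltn_trans (leq0n d) (eq_leq (esym szxs))).
  case: nC0e; have [_ _ h] := gen; apply: (h (C 0%N)) => //.
  - by apply: prime_idl.
  - by move=> x xxs; apply: NNPP => nx; apply: no; exists x.
  - by apply/top; apply: (chain_le hC) C1e; rewrite ?szxs.
have pe := perm_to_rem axs.
have sz' : size (rem a xs) = d by rewrite size_rem // szxs.
move: hC top; rewrite szxs => hC top.
have [|C' [hC' top' C'a sub]] := chain_push (x := a) hC.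
  by apply/top; case: gen => _ + _; apply.
have [|||||C'J [ys [szys genys flag]]] := IH (rem a xs) (add1 J a) C' sz'.
- exact: add1_idl.
- exact: (generates_add1 _ _ pe).
- by rewrite sz'.
- apply: add1_min => //; last by move=> x /JC/sub.
  by apply: prime_idl; case: hC' => + _; apply.
- by move=> x; rewrite sz' top'.
have CJ x : C 0%N x -> J x.
  move=> Cx; have [|v Cv|u [nu Ju]] :=
    @nakayama_ideal _ m a J (C 0%N) noethR pm _ iJ _ x Cx.
  - by case: gen => _ + _; apply.
  - have [r Jr] := C'J _ (sub _ Cv); exists 1, r; split; first exact: prime1.
      have [_ _ pM] := p0; case: (pM r a) => //.
      have -> : r * a = v - (v - r * a) by ring.
      by apply: idlB; [apply: prime_idl|done|apply: JC].
    by rewrite mul1r [a * r]mulrC.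
  - exact: (loc J iJ u).
split=> //; exists (a :: ys); split; first by rewrite /= szys sz'.
- have [h1 h2 h3] := genys; split.
  + by move=> x Jx; apply: h1; apply: add1_sub.
  + move=> x; rewrite in_cons => /orP[/eqP->|/h2//].
    by apply: h1; apply: add1_in.
  + move=> I iI JI sI; apply: h3 => //.
      by apply: add1_min => //; apply: sI; rewrite mem_head.
    by move=> x xs_; apply: sI; rewrite in_cons xs_ orbT.
- split=> //; apply: (@prime_ext (C 0%N)) => // x.
  by split; [apply: CJ|apply: JC].
Qed.

End Dimension.

(** * Bases of submodules of R^n modulo a prime *)

Definition entrywise (R : comNzRingType) n (q : R -> Prop) (v : 'rV[R]_n) :=
  forall j, q (v 0 j).

Lemma entrywise_submod (R : comNzRingType) n (q : R -> Prop) :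
  is_ideal q -> is_submod (@entrywise R n q).
Proof.
move=> iq; split.
- by move=> j; rewrite mxE; apply: idl0.
- by move=> v w hv hw j; rewrite mxE; apply: idlD.
- by move=> r v hv j; rewrite mxE; apply: idlM.
Qed.

Lemma entrywise_mul (R : comNzRingType) n p (q : R -> Prop) (v : 'rV[R]_n) (A : 'M_(n, p)) :
  is_ideal q -> entrywise q v -> entrywise q (v *m A).
Proof. by move=> iq hv j; rewrite mxE; apply: idl_sum => // k _; apply: idlMr. Qed.

Lemma noeth_rV (R : comNzRingType) n : noetherian R -> noeth_module 'rV[R]_n.
Proof.
move=> nR; elim: n => [|n IH] M sM.
  exists [::]; split=> // M' sM' _ v _; rewrite (thinmx0 v); exact: submod0.
have [|s0 [s0M gen0]] := IH (fun w => M (row_mx 0 w : 'rV_(1 + n))).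
  split.
  - by rewrite row_mx0; apply: submod0.
  - by move=> v w hv hw; rewrite -[0]addr0 -add_row_mx; apply: submodD.
  - by move=> r v hv; rewrite -[0](scaler0 _ r) -scale_row_mx; apply: submodZ.
pose A (a : R) := exists v, M v /\ v 0 0 = a.
have iA : is_ideal A.
  split; first by exists 0; rewrite mxE; split=> //; apply: submod0.
  - move=> a b [v [Mv <-]] [w [Mw <-]]; exists (v + w); rewrite mxE; split=> //.
    exact: submodD.
  - move=> r a [v [Mv <-]]; exists (r *: v); rewrite mxE; split=> //.
    exact: submodZ.
have [s1 [s1A gen1]] := noeth_fg nR iA.
have [s1' [s1'M s1'P]] : exists s : seq 'rV[R]_(n.+1), (forall v, v \in s -> M v) /\
    forall a, a \in s1 -> exists2 v, v \in s & v 0 0 = a.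
  elim: s1 s1A {gen1} => [|a s IHs] sA; first by exists [::].
  have [v [Mv va]] := sA a (mem_head _ _).
  have [|t [tM tP]] := IHs; first by move=> b bs; apply: sA; rewrite in_cons bs orbT.
  exists (v :: t); split.
    by move=> w; rewrite in_cons => /orP[/eqP->|/tM].
  move=> b; rewrite in_cons => /orP[/eqP->|/tP[w wt wb]].
    by exists v => //; rewrite mem_head.
  by exists w => //; rewrite in_cons wt orbT.
exists (s1' ++ [seq (row_mx 0 w : 'rV_(1 + n)) | w <- s0]); split.
  by move=> v; rewrite mem_cat => /orP[/s1'M//|/mapP[w /s0M ? ->]].
move=> M' sM' hM' v Mv.
have [w [Mw M'w wv]] : exists w, [/\ M w, M' w & w 0 0 = v 0 0].
  apply: (gen1 (fun a => exists w, [/\ M w, M' w & w 0 0 = a])); last by exists v.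
    split.
    - by exists 0; rewrite mxE; split=> //; apply: submod0.
    - move=> a b [u [Mu M'u <-]] [w [Mw M'w <-]]; exists (u + w).
      by rewrite mxE; split=> //; apply: submodD.
    - move=> r a [u [Mu M'u <-]]; exists (r *: u).
      by rewrite mxE; split=> //; apply: submodZ.
  move=> a /s1'P[w ws wa]; exists w; split=> //; first exact: s1'M.
  by apply: hM'; rewrite mem_cat ws.
have -> : v = w + (v - w) by rewrite addrC subrK.
apply: submodD => //.
have e : v - w = row_mx 0 (rsubmx (v - w : 'rV_(1 + n))) :> 'rV_(1 + n).
  rewrite -{1}[v - w](@hsubmxK _ 1 1 n); congr row_mx.
  apply/rowP => j; rewrite ord1 !mxE.
  have -> : lshift n (0 : 'I_1) = 0 by apply/val_inj.
  by rewrite wv subrr.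
rewrite e; apply: (gen0 (fun w => M' (row_mx 0 w : 'rV_(1 + n)))); last 1 first.
- by rewrite -e; apply: submodB.
- split.
  + by rewrite row_mx0; apply: submod0.
  + by move=> u u' hu hu'; rewrite -[0]addr0 -add_row_mx; apply: submodD.
  + by move=> r u hu; rewrite -[0](scaler0 _ r) -scale_row_mx; apply: submodZ.
- by move=> u us; apply: hM'; rewrite mem_cat; apply/orP; right; apply/mapP; exists u.
Qed.

Section LocalBases.
Variables (R : comNzRingType) (m : R -> Prop).
Hypotheses (noethR : noetherian R) (pm : is_prime_ideal m).

(** The rows of [g] form a basis, up to multipliers outside m, of the image of [Z] in (R/q)^n. *)
Definition basis_mod (q : R -> Prop) n (Z : 'rV[R]_n -> Prop) r (g : 'M[R]_(r, n)) :=
  [/\ forall i, Z (row i g),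
      forall v, Z v -> exists u c, ~ m u /\ entrywise q (u *: v - c *m g) &
      forall c, entrywise q (c *m g) -> entrywise q c].

Lemma submod_mulmx n (Z : 'rV[R]_n -> Prop) r (g : 'M[R]_(r, n)) c :
  is_submod Z -> (forall i, Z (row i g)) -> Z (c *m g).
Proof.
move=> sZ hg; rewrite mulmx_sum_row; apply: (big_ind Z); first exact: submod0.
  by move=> v w; apply: submodD.
by move=> i _; apply: submodZ.
Qed.

(* q + (z) = m makes (R / q)_m a discrete valuation ring or, if z \in q, a field. *)
Lemma dvr_basis q z n (Z : 'rV[R]_n -> Prop) :
  is_prime_ideal q -> (forall x, q x -> m x) -> m z ->
  (forall a, m a -> add1 q z a) -> is_submod Z ->
  exists r (g : 'M_(r, n)), basis_mod q Z g.
Proof.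
move=> pq qm mz mqz sZ; have iq := prime_idl pq.
have sq k := @entrywise_submod R k q iq.
pose gens r (g : 'M[R]_(r, n)) := (forall i, Z (row i g)) /\
  forall v, Z v -> exists u c, ~ m u /\ entrywise q (u *: v - c *m g).
have [r [g hg]] : exists r (g : 'M_(r, n)), gens r g.
  have [s [sZ' gen]] := noeth_rV noethR sZ.
  pose g := \matrix_(i < size s) s`_i; exists (size s), g.
  have rg i : row i g = s`_i by rewrite rowK.
  split; first by move=> i; rewrite rg; apply: sZ'; apply: mem_nth.
  move=> v Zv; have [] := gen (fun v => exists c : 'rV_(size s), v = c *m g) _ _ v Zv.
  - split; first by exists 0; rewrite mul0mx.
    + by move=> _ _ [c ->] [d ->]; exists (c + d); rewrite mulmxDl.
    + by move=> a _ [c ->]; exists (a *: c); rewrite scalemxAl.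
  - move=> w /(nthP 0)[i lt <-]; exists (delta_mx 0 (Ordinal lt)).
    by rewrite -rowE rg.
  - move=> c ->; exists 1, c; split; first exact: prime1.
    by rewrite scale1r subrr; apply: (submod0 (sq _)).
(* A generating family of minimal length; a nontrivial relation among its rows will shorten it. *)
have [r0 [[g0 hg0] minr]] : exists r0, (exists g : 'M_(r0, n), gens r0 g) /\
    forall k (g : 'M_(k, n)), gens k g -> (r0 <= k)%N.
  apply: NNPP => no.
  have : forall k j, (j <= k)%N -> ~ exists g : 'M_(j, n), gens j g.
    elim=> [|k IH] j; first by rewrite leqn0 => /eqP-> h; apply: no; exists 0%N.
    rewrite leq_eqVlt => /orP[/eqP->|]; last exact: IH.
    move=> h; apply: no; exists k.+1; split=> // l g' hg'; rewrite ltnNge; apply/negP => lk.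
    by apply: (IH l lk); exists g'.
  by move=> /(_ r r (leqnn _)); apply; exists g.
exists r0, g0; have [g0Z g0gen] := hg0; split=> // c hc; apply: NNPP => nc.
(* Extract the largest power of z from the relation c. If no entry ever left m, one could divide by
   z forever, and Nakayama would make c vanish modulo q. *)
have [k [c' [i [e nci]]]] : exists k c' i, entrywise q (c - z ^+ k *: c') /\ ~ m (c' 0 i).
  apply: NNPP => bad.
  pose B (d : 'rV[R]_r0) := ~ entrywise q d /\
    ~ exists k c' i, entrywise q (d - z ^+ k *: c') /\ ~ m (c' 0 i).
  have [|u [nu qu]] := nakayama (x := z) (M := B) (noeth_rV noethR) pm mz (sq r0) _ (conj nc bad).
    move=> d [nd bd].
    have dm j : exists b, q (d 0 j - b * z).
      apply: mqz; apply: NNPP => nm; apply: bd; exists 0%N, d, j.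
      by rewrite expr0 scale1r subrr; split=> //; apply: (submod0 (sq _)).
    have [b hb] := fin_all_exists dm.
    have e : entrywise q (d - z *: \row_j b j).
      by move=> j; have := hb j; rewrite !mxE mulrC.
    exists 1, (\row_j b j); rewrite scale1r; split=> //; first exact: prime1.
    split.
      move=> qb; apply: nd.
      have -> : d = (d - z *: \row_j b j) + z *: \row_j b j by rewrite subrK.
      by apply: (submodD (sq _)) => //; apply: (submodZ _ (sq _)).
    move=> [k [c' [i [e' nc']]]]; apply: bd; exists k.+1, c', i; split=> //.
    have -> : d - z ^+ k.+1 *: c' =
      (d - z *: \row_j b j) + z *: (\row_j b j - z ^+ k *: c').
      by rewrite scalerBr scalerA -exprS addrA subrK.
    by apply: (submodD (sq _)) => //; apply: (submodZ _ (sq _)).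
  apply: nc => j; have := qu j; rewrite mxE; have [_ _ pM] := pq.
  by case/pM => // /qm.
have nz : ~ q (z ^+ k).
  move=> qz; apply: nc.
  have -> : c = (c - z ^+ k *: c') + z ^+ k *: c' by rewrite subrK.
  apply: (submodD (sq _)) => // j; rewrite mxE; exact: idlMr.
have hc' : entrywise q (c' *m g0).
  move=> j; have [_ _ pM] := pq.
  have : q ((z ^+ k *: (c' *m g0)) 0 j).
    have -> : z ^+ k *: (c' *m g0) = c *m g0 - (c - z ^+ k *: c') *m g0.
      by rewrite mulmxBl opprB addrC subrK scalemxAl.
    suff : entrywise q (c *m g0 - (c - z ^+ k *: c') *m g0) by apply.
    by apply: (submodB (sq _)) => //; apply: entrywise_mul.
  by rewrite mxE => /pM[].
case: r0 => [|r1] in g0 hg0 minr g0Z g0gen c hc nc c' i e nci hc' *; first by case: i nci.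
have : (r1.+1 <= r1)%N; last by rewrite ltnn.
(* After cancelling z^k, c' is itself a relation, and its entry at i is a unit at m; so row i is
   redundant. *)
apply: (minr _ (row' i g0)); split.
  by move=> j; have := g0Z (lift i j); congr Z; apply/rowP => l; rewrite !mxE.
move=> v /g0gen[u [d [nu hd]]].
exists (c' 0 i * u), (col' i (c' 0 i *: d - d 0 i *: c')); split; first exact: primeM.
have -> : col' i (c' 0 i *: d - d 0 i *: c') *m row' i g0 =
  (c' 0 i *: d - d 0 i *: c') *m g0.
  apply/rowP => j; rewrite !mxE [RHS](bigD1_ord i) //= !mxE.
  rewrite [d 0 i * _]mulrC subrr mul0r add0r.
  by apply: eq_bigr => l _; rewrite !mxE.
have -> : (c' 0 i * u) *: v - (c' 0 i *: d - d 0 i *: c') *m g0 =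
   c' 0 i *: (u *: v - d *m g0) + d 0 i *: (c' *m g0).
  by rewrite scalerBr mulmxBl -!scalemxAl scalerA opprB addrA addrAC.
by apply: (submodD (sq _)) => //; apply: (submodZ _ (sq _)).
Qed.

(** The hypothesis on [Z] says that y is regular on (R/q)^n modulo the image of [Z]. An element of
    [Z] differs from the span of [g] by y w', regularity puts w' in [Z], and Nakayama lifts
    generation. Likewise a relation is y times a relation, so Nakayama lifts independence. *)
Lemma lift_basis q y n (Z : 'rV[R]_n -> Prop) r (g : 'M_(r, n)) :
  is_prime_ideal q -> (forall x, q x -> m x) -> m y -> is_submod Z ->
  (~ q y -> forall w v, Z v -> entrywise q (y *: w - v) ->
     exists v', Z v' /\ entrywise q (w - v')) ->
  basis_mod (add1 q y) Z g -> basis_mod q Z g.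
Proof.
move=> pq qm my sZ Zsat [gZ ggen gind]; have iq := prime_idl pq.
have sq k := @entrywise_submod R k q iq.
have add1q (k : nat) (w : 'rV[R]_k) : entrywise (add1 q y) w ->
    exists w', entrywise q (w - y *: w').
  move=> h; have [b hb] := fin_all_exists h.
  by exists (\row_j b j) => j; have := hb j; rewrite !mxE mulrC.
have [qy|nqy] := classic (q y).
  have add1E k (w : 'rV[R]_k) : entrywise (add1 q y) w -> entrywise q w.
    by move=> h j; apply: (add1_min iq _ qy (h j)).
  split=> //.
    by move=> v /ggen[u [c [nu /add1E]]]; exists u, c.
  by move=> c hc; apply: add1E; apply: gind => j; apply: add1_sub.
split=> //.
  move=> v Zv.
  pose N (w : 'rV[R]_n) := exists c, entrywise q (w - c *m g).
  have [||u [nu [c Nc]]] := nakayama (x := y) (N := N) (noeth_rV noethR) pm my _ _ Zv.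
  - split.
    + by exists 0; rewrite mul0mx subrr; apply: (submod0 (sq _)).
    + move=> w w' [c hc] [d hd]; exists (c + d).
      have -> : w + w' - (c + d) *m g = (w - c *m g) + (w' - d *m g).
        by rewrite mulmxDl opprD addrACA.
      exact: (submodD (sq _)).
    + move=> a w [c hc]; exists (a *: c).
      by rewrite -scalemxAl -scalerBr; apply: (submodZ _ (sq _)).
  - move=> w /[dup] Zw /ggen[u [c [nu /add1q[w' hw']]]].
    have [||v' [Zv' hv']] := Zsat nqy w' (u *: w - c *m g).
    + by apply: submodB => //; [apply: submodZ|apply: submod_mulmx].
    + by rewrite -opprB; apply: (submodN (sq _)).
    exists u, v'; split=> //; exists c.
    have -> : u *: w - y *: v' - c *m g = (u *: w - c *m g - y *: w') + y *: (w' - v').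
      by rewrite scalerBr addrA subrK addrAC.
    by apply: (submodD (sq _)) => //; apply: (submodZ _ (sq _)).
  by exists u, c.
move=> c hc.
have [|u [nu qu]] := nakayama (x := y) (M := fun c => entrywise q (c *m g))
     (noeth_rV noethR) pm my (sq r) _ hc.
  move=> d hd; have [|d' hd'] := add1q _ d; first by apply: gind => j; apply: add1_sub.
  exists 1, d'; rewrite scale1r; split=> //; first exact: prime1.
  move=> j; have : q ((y *: (d' *m g)) 0 j).
    have -> : y *: (d' *m g) = d *m g - (d - y *: d') *m g.
      by rewrite mulmxBl opprB addrC subrK scalemxAl.
    suff : entrywise q (d *m g - (d - y *: d') *m g) by apply.
    by apply: (submodB (sq _)) => //; apply: entrywise_mul.
  by rewrite mxE; have [_ _ pM] := pq; case/pM.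
move=> j; have := qu j; rewrite mxE; have [_ _ pM] := pq.
by case/pM => // /qm.
Qed.

End LocalBases.

(** * The Hilbert-Burch factorization *)

Lemma det_mul_narrow (R : comNzRingType) r p (A : 'M[R]_(r + p.+1, r)) (B : 'M_(r, r + p.+1)) :
  \det (A *m B) = 0.
Proof.
have -> : A *m B = row_mx A (0 : 'M_(_, p.+1)) *m col_mx B (0 : 'M_(p.+1, _)).
  by rewrite mul_row_col mul0mx addr0.
rewrite det_mulmx; suff -> : \det (col_mx B (0 : 'M_(p.+1, _))) = 0 by rewrite mulr0.
rewrite (expand_det_row _ (rshift r ord0)) big1 // => j _.
by rewrite col_mxEd mxE mul0r.
Qed.

(* McCoy's theorem over R / C. *)
Lemma mccoy (R : comNzRingType) (C : R -> Prop) t r n (g : 'M[R]_(r, n)) k :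
  is_ideal C -> (k <= r)%N -> (forall w, entrywise C (w *m g) -> entrywise C w) ->
  (forall (a : 'I_k -> 'I_r) (b : 'I_k -> 'I_n), C (t * \det (mxsub a b g))) -> C t.
Proof.
move=> iC + inj; elim: k => [|k IH] kr minors.
  have := minors (fun i => match i with Ordinal _ h => False_rect _ (notF h) end)
    (fun i => match i with Ordinal _ h => False_rect _ (notF h) end).
  by rewrite det_mx00 mulr1.
apply: (IH (ltnW kr)) => a b.
have [i0 hi0] : exists i0, forall l, a l != i0.
  have /subsetPn[i0 _ ni0] : ~~ ([set: 'I_r] \subset [set a l | l in [set: 'I_k]]).
    apply/negP => /subset_leq_card; rewrite cardsT card_ord leqNgt => /negP; apply.
    by apply: leq_ltn_trans (leq_imset_card _ _) _; rewrite cardsT card_ord.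
  exists i0 => l; apply: contra ni0 => /eqP <-; exact: imset_f.
pose a' l := if unlift ord0 l is Some l' then a l' else i0.
pose b' j l := if unlift ord0 l is Some l' then b l' else j.
(* Expansion along a new first column j, with i0 as new first row. The vector w carries t times
   these cofactors, so w g lists (k+1)-minors times t, all in C. Injectivity puts w in C, and its
   entry at i0 is t times the given k-minor because [a] misses i0. *)
pose cof (l : 'I_k.+1) := (-1) ^+ l * \det (mxsub (a' \o lift l) b g).
have cofE j l : cofactor (mxsub a' (b' j) g) l ord0 = cof l.
  rewrite /cofactor addn0; congr (_ * \det _).
  by apply/matrixP => p q; rewrite !mxE /= /b' (liftK (@ord0 k)).
pose w : 'rV_r := \sum_l (t * cof l) *: delta_mx 0 (a' l).
have Cw : entrywise C w.
  apply: inj => j; suff -> : (w *m g) 0 j = t * \det (mxsub a' (b' j) g) by [].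
  rewrite (expand_det_col _ ord0) mulr_sumr /w mulmx_suml summxE.
  apply: eq_bigr => l _; rewrite -scalemxAl -rowE !mxE cofE /b' unlift_none.
  by ring.
have := Cw i0; suff -> : w 0 i0 = t * \det (mxsub a b g) by [].
rewrite /w summxE (bigD1 ord0) //= big1 ?addr0; last first.
  move=> l; rewrite eq_sym => /unlift_some[l' -> _].
  by rewrite !mxE /a' liftK (eq_sym i0) (negbTE (hi0 l')) andbF mulr0.
rewrite !mxE /a' unlift_none !eqxx mulr1 /cof expr0 mul1r; congr (_ * \det _).
by apply/matrixP => p q; rewrite !mxE /= /a' (liftK (@ord0 k)).
Qed.

Section Factor.
Variables (R : comNzRingType) (m : R -> Prop).
Hypotheses (noethR : noetherian R) (pm : is_prime_ideal m).
Let zero : R -> Prop := eq^~ 0.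
Hypothesis domR : is_prime_ideal zero.
Let im := prime_idl pm.

Lemma dom_mul_eq0 (x y : R) : x * y = 0 -> x <> 0 -> y = 0.
Proof. by case: domR => _ _ h /h[]. Qed.

Lemma dom_mulfI (a x y : R) : a <> 0 -> a * x = a * y -> x = y.
Proof.
move=> na e; apply/eqP; rewrite -subr_eq0; apply/eqP; apply: dom_mul_eq0 na.
by rewrite mulrBr e subrr.
Qed.

Lemma notin_prime_neq0 u : ~ m u -> u <> 0.
Proof. by move=> nu e; apply: nu; rewrite e; apply: idl0. Qed.

Lemma saturation_princ_idl c : is_ideal (saturation m (princ c)).
Proof. by apply: saturation_idl => //; apply: princ_idl. Qed.

(* The localization of J at m has grade at least 2 or is the unit ideal. *)
Definition grade2 (J : R -> Prop) := forall c t, c <> 0 ->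
  (forall j, J j -> saturation m (princ c) (t * j)) -> saturation m (princ c) t.

Definition entries n (h : 'cV[R]_n) : R -> Prop := fun a => exists i, a = h i 0.

Definition syz n (f : 'cV[R]_n) (v : 'rV[R]_n) := v *m f = 0.

Lemma syz_submod n (f : 'cV_n) : is_submod (syz f).
Proof.
split; first exact: mul0mx.
- by move=> v w hv hw; rewrite /syz mulmxDl hv hw addr0.
- by move=> r v hv; rewrite /syz -scalemxAl hv scaler0.
Qed.

(** R^n modulo the syzygies is the ideal (f). Lifting from (x, y) to (x) needs y regular on its
    reduction modulo x, which follows from the primality of (x) and the hypothesis that (f) meets
    (x) in x(f); lifting to (0) only needs that an ideal of a domain is torsion-free. *)
Lemma syz_basis n (f : 'cV_n) x y z :
  prime_flag zero [:: x; y; z] -> generates m zero [:: x; y; z] ->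
  (forall (v : 'rV_n) c, (v *m f) 0 0 = c * x -> exists w : 'rV_n, v *m f = x *: (w *m f)) ->
  exists r (g : 'M_(r, n)), basis_mod m zero (syz f) g.
Proof.
move=> [_ [p1 [p2 _]]] gen xsat; have [_ hm gm] := gen.
have mx : m x by apply: hm; rewrite !inE eqxx.
have my : m y by apply: hm; rewrite !inE eqxx orbT.
have mz : m z by apply: hm; rewrite !inE eqxx !orbT.
have i0 := prime_idl domR; have i1 := prime_idl p1; have i2 := prime_idl p2.
have zm a : zero a -> m a by move=> ->; apply: idl0.
have q1m : forall a, add1 zero x a -> m a by apply: add1_min.
have q2m : forall a, add1 (add1 zero x) y a -> m a by apply: add1_min.
have [||r [g hg]] := @dvr_basis _ m noethR pm (add1 (add1 zero x) y) z n (syz f) p2 q2m mz.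
- apply: gm; first exact: add1_idl.
    by move=> a za; do 3!apply: add1_sub.
  move=> a; rewrite !inE => /or3P[]/eqP ->.
  + by do 2!apply: add1_sub; apply: add1_in.
  + by apply: add1_sub; apply: add1_in.
  + exact: add1_in.
- exact: syz_submod.
exists r, g; apply: (lift_basis noethR pm domR zm mx (syz_submod f)).
  move=> nx w v Sv hw; exists w; split; last first.
    by rewrite subrr => j; rewrite mxE.
  have {}hw : x *: w = v.
    by apply/rowP => j; apply/eqP; rewrite -subr_eq0; apply/eqP; have := hw j; rewrite !mxE.
  have : x *: (w *m f) = 0 by rewrite scalemxAl hw.
  move=> /matrixP e; apply/matrixP => i j; have := e i j; rewrite !mxE => /dom_mul_eq0; exact.
apply: (lift_basis noethR pm p1 q1m my (syz_submod f)) hg.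
move=> ny w v Sv hw.
have : add1 zero x (((y *: w - v) *m f) 0 0) by apply: entrywise_mul.
rewrite mulmxBl Sv subr0 -scalemxAl mxE.
have [_ _ pM] := p1; case/pM => // -[c /eqP]; rewrite subr_eq0 => /eqP/xsat[w' e].
exists (w - x *: w'); split; first by rewrite /syz mulmxBl -scalemxAl e subrr.
move=> j; rewrite opprB addrC subrK mxE; apply: idlMr => //; exact: add1_in.
Qed.

(* Hilbert-Burch: f is, up to a common factor, the vector of maximal minors of g. *)
Lemma hilbert_burch n (f : 'cV_n) i0 r (g : 'M_(r, n)) :
  f i0 0 <> 0 -> basis_mod m zero (syz f) g ->
  exists s (h : 'cV_n) u, [/\ ~ m u, u *: f = s *: h & grade2 (entries h)].
Proof.
move=> nf0 [gS ggen gind].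
have gf : g *m f = 0.
  by apply/row_matrixP => i; rewrite row_mul row0; apply: gS.
(* If n <= r, every n-minor of g annihilates f and so vanishes, against McCoy's theorem for the
   injective g. *)
have ltrn : (r < n)%N.
  rewrite ltnNge; apply/negP => nr.
  have : (1 : R) = 0; last by apply/eqP; rewrite oner_eq0.
  apply: (@mccoy _ zero 1 r n g n) => //; first exact: prime_idl.
  move=> a b; rewrite mul1r.
  have -> : mxsub a b g = rowsub a g *m colsub b 1%:M.
    by rewrite mulmx_colsub mulmx1; apply/matrixP => i j; rewrite !mxE.
  rewrite det_mulmx; suff -> : \det (rowsub a g) = 0 by rewrite mul0r.
  have : \det (rowsub a g) *: f = 0.
    rewrite -mul_scalar_mx -mul_adj_mx -mulmxA mul_rowsub_mx gf.
    by rewrite (_ : rowsub a 0 = 0) ?mulmx0 //; apply/matrixP => i j; rewrite !mxE.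
  move=> /matrixP/(_ i0 0); rewrite !mxE mulrC => /dom_mul_eq0; exact.
(* If n - 1 > r, write the n - 1 Koszul syzygies f_i0 e_j - f_j e_i0 through the r rows of g, up to
   multipliers. Without column i0 they form a diagonal matrix with nonzero entries, yet it factors
   through rank r and has determinant zero. *)
have lenr : (n <= r.+1)%N.
  rewrite leqNgt; apply/negP => /subnK e.
  have {}e : n = (r + (n - r.+2).+1).+1 by rewrite -{1}e !addnS addnC.
  move: (n - r.+2)%N e => p e; move: f i0 nf0 g gS ggen gind gf {ltrn}; rewrite e.
  move=> f i0 nf0 g _ ggen _ gf.
  pose B j : 'rV_((r + p.+1).+1) :=
    f i0 0 *: delta_mx 0 (lift i0 j) - f (lift i0 j) 0 *: delta_mx 0 i0.
  have SB j : syz f (B j).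
    rewrite /syz mulmxBl -!scalemxAl -!rowE; apply/rowP => k.
    by rewrite ord1 !mxE mulrC subrr.
  have hc j : exists uc : R * 'rV_r, ~ m uc.1 /\ uc.1 *: B j = uc.2 *m g.
    have [u [c [nu h]]] := ggen _ (SB j); exists (u, c); split=> //=.
    by apply/eqP; rewrite -subr_eq0; apply/eqP/rowP => k; rewrite [RHS]mxE; apply: h.
  have [uc huc] := fin_all_exists hc.
  have : \det (\matrix_j (uc j).2 *m col' i0 g) = 0 by apply: det_mul_narrow.
  have -> : \matrix_j (uc j).2 *m col' i0 g = diag_mx (\row_j ((uc j).1 * f i0 0)).
    apply/matrixP => j k; have [_ /rowP/(_ (lift i0 k))] := huc j.
    rewrite !mxE !eqxx /= (inj_eq lift_inj) [lift _ _ == i0]eq_sym.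
    rewrite (negbTE (neq_lift _ _)) mulr0 subr0 => e'.
    under eq_bigr do rewrite !mxE.
    rewrite -e' eq_sym; case: eqP => [->|]; by rewrite ?mulr1 ?mulr1n ?mulr0 ?mulr0n.
  rewrite det_diag; apply: (big_ind (fun a : R => a <> 0)).
  - by apply/eqP; rewrite oner_eq0.
  - by move=> a b na nb /dom_mul_eq0 h; apply: nb; apply: h.
  - move=> j _; rewrite mxE => /dom_mul_eq0 h; apply: nf0; apply: h.
    by apply: notin_prime_neq0; case: (huc j).
have en : n = r.+1 by apply/eqP; rewrite eqn_leq lenr.
move: f i0 nf0 g gS ggen gind gf {ltrn lenr}; rewrite en => {en}.
move=> f i0 nf0 g _ ggen gind gf.
pose d : 'cV_r.+1 := \col_i ((-1) ^+ i * \det (col' i g)).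
(* The r columns chosen by [b] miss some index i, so each r-minor, even with repeated columns, is a
   multiple of d_i; McCoy's theorem can be tested on d alone. *)
have minors (C : R -> Prop) t : is_ideal C -> (forall i, C (t * d i 0)) ->
    (forall w, entrywise C (w *m g) -> entrywise C w) -> C t.
  move=> iC hd inj; apply: (@mccoy _ C t r r.+1 g r iC (leqnn r) inj) => a b.
  have [i hi] : exists i, forall l, i != b l.
    have /subsetPn[i _ ni] : ~~ ([set: 'I_r.+1] \subset [set b l | l in [set: 'I_r]]).
      apply/negP => /subset_leq_card; rewrite cardsT card_ord leqNgt => /negP; apply.
      by apply: leq_ltn_trans (leq_imset_card _ _) _; rewrite cardsT card_ord.
    exists i => l; apply: contra ni => /eqP ->; exact: imset_f.
  have [sg hsg] : exists sg : 'I_r -> 'I_r, forall l, b l = lift i (sg l).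
    apply: (@fin_all_exists _ (fun _ => 'I_r) (fun l l' => b l = lift i l')) => l.
    by have [l' ->] := unlift_some (hi l); exists l'.
  have -> : mxsub a b g = rowsub a 1%:M *m col' i g *m colsub sg 1%:M.
    rewrite mul_rowsub_mx mul1mx mulmx_colsub mulmx1.
    by apply/matrixP => p q; rewrite !mxE hsg.
  rewrite !det_mulmx; have := hd i; rewrite mxE => hd'.
  have -> : t * (\det (rowsub a 1%:M) * \det (col' i g) * \det (colsub sg 1%:M)) =
    ((-1) ^+ i * (-1) ^+ i) *
      (t * (\det (rowsub a 1%:M) * \det (col' i g) * \det (colsub sg 1%:M))).
    by rewrite -exprD addnn -signr_odd odd_double expr0 mul1r.
  have -> : (-1) ^+ i * (-1) ^+ i *
     (t * (\det (rowsub a 1%:M) * \det (col' i g) * \det (colsub sg 1%:M))) =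
    ((-1) ^+ i * \det (rowsub a 1%:M) * \det (colsub sg 1%:M)) *
      (t * ((-1) ^+ i * \det (col' i g))) by ring.
  exact: idlM.
(* Put the unit row e_j on top of g. The resulting M has determinant d_j, and M f has f_j as its
   only possibly nonzero entry; apply the adjugate of M. *)
have fd i j : f i 0 * d j 0 = f j 0 * d i 0.
  pose M : 'M_(1 + r) := col_mx (delta_mx 0 j) g.
  have co k : cofactor M 0 k = d k 0.
    rewrite /cofactor /d mxE add0n; congr (_ * \det _).
    apply/matrixP => p q; rewrite !mxE.
    have -> : lift 0 p = rshift 1 p by apply/val_inj.
    by rewrite (unsplitK (inr p)).
  have M0 k : M 0 k = (k == j)%:R.
    have -> : (0 : 'I_(1 + r)) = lshift r 0 by apply/val_inj.
    by rewrite col_mxEu !mxE eqxx.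
  have dM : \det M = d j 0.
    rewrite (expand_det_row _ 0) (bigD1 j) //= big1 ?addr0.
      by rewrite co M0 eqxx mul1r.
    by move=> k nk; rewrite M0 (negbTE nk) mul0r.
  have : (\adj M *m M *m f) i 0 = d j 0 * f i 0.
    by rewrite mul_adj_mx mul_scalar_mx mxE dM.
  rewrite mulrC => <-; rewrite -mulmxA mul_col_mx gf mxE (bigD1 0) //= big1 ?addr0.
    rewrite mxE co mulrC; congr (_ * _).
    have -> : (0 : 'I_(1 + r)) = lshift r 0 by apply/val_inj.
    by rewrite col_mxEu -rowE mxE.
  move=> k nk; rewrite eq_sym in nk; have [k' -> _] := unlift_some nk.
  have -> : lift 0 k' = rshift 1 k' by apply/val_inj.
  by rewrite col_mxEd [X in _ * X]mxE mulr0.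
(* By [minors] it suffices that g stays injective modulo c. If w g = c v, then v is a syzygy, hence
   a combination w' g, and independence gives w = c w', all up to multipliers. *)
have gr : grade2 (entries d).
  move=> c t nc hd; apply: (minors _ t (saturation_princ_idl c)).
    by move=> i; apply: hd; exists i.
  move=> w hw j.
  have [v [u [nu e]]] : exists v u, ~ m u /\ u *: (w *m g) = c *: v.
    have [uj hu] := fin_all_exists hw.
    have h2 k : exists b, (\prod_l uj l) * (w *m g) 0 k = b * c.
      have [nu [b e]] := hu k; exists ((\prod_(l | l != k) uj l) * b).
      by rewrite (bigD1 k) //= -[RHS]mulrA -e; ring.
    have [b hb] := fin_all_exists h2.
    exists (\row_k b k), (\prod_l uj l); split.
      apply: (big_ind (fun a => ~ m a)); first exact: prime1.
        by move=> p q; apply: primeM.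
      by move=> k _; case: (hu k).
    by apply/rowP => k; rewrite mxE hb !mxE mulrC.
  have Sv : syz f v.
    rewrite /syz; apply/matrixP => i k; apply: (@dom_mulfI c) => //.
    have : c *: (v *m f) = 0 by rewrite scalemxAl -e -scalemxAl -mulmxA gf mulmx0 scaler0.
    by move=> /matrixP/(_ i k); rewrite !mxE mulr0.
  have [u' [w' [nu' hw']]] := ggen v Sv.
  have e2 : entrywise zero ((u' *: (u *: w) - c *: w') *m g).
    suff -> : (u' *: (u *: w) - c *: w') *m g = c *: (u' *: v - w' *m g).
      by move=> k; have := hw' k; rewrite !mxE => ->; rewrite mulr0.
    by rewrite mulmxBl -!scalemxAl e scalerBr !scalerA [c * u']mulrC.
  exists (u' * u); split; first exact: primeM.
  exists (w' 0 j); have := gind _ e2 j; rewrite !mxE => /eqP; rewrite subr_eq0 => /eqP.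
  by rewrite mulrA => ->; rewrite mulrC.
have nd0 : d i0 0 <> 0.
  move=> d0; have : (1 : R) = 0; last by apply/eqP; rewrite oner_eq0.
  apply: (minors zero) => //; first exact: prime_idl.
  move=> i; rewrite mul1r; apply: (dom_mul_eq0 (_ : f i0 0 * _ = 0) nf0).
  by rewrite fd d0 mulr0.
(* Every f_i0 d_j = f_j d_i0 is divisible by d_i0, so grade two makes d_i0 divide f_i0 up to a
   multiplier; s is the quotient. *)
have [|u [nu [s e]]] := gr (d i0 0) (f i0 0) nd0.
  move=> _ [i ->]; rewrite fd; apply: saturation_sub => //; by exists (f i 0).
exists s, d, u; split=> //; apply/matrixP => i k; rewrite ord1 [LHS]mxE [RHS]mxE.
apply: (dom_mulfI nd0); have -> : d i0 0 * (u * f i 0) = u * (f i 0 * d i0 0) by ring.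
by rewrite fd mulrA e; ring.
Qed.


Lemma xpow_cancel x N a w b : is_prime_ideal (add1 zero x) -> x <> 0 ->
  ~ add1 zero x a -> a * w = b * x ^+ N -> exists w', w = w' * x ^+ N.
Proof.
move=> px nx na; elim: N w b => [|N IH] w b e; first by exists w; rewrite expr0 mulr1.
have [w1 ew] : exists w1, w = w1 * x.
  have [_ _ pM] := px; case: (pM a w) => //.
    by exists (b * x ^+ N); rewrite e -mulrA -exprSr subrr.
  by move=> [w1 /eqP]; rewrite subr_eq0 => /eqP; exists w1.
have [|w' ew'] := IH w1 b.
  by apply: (dom_mulfI nx); rewrite mulrCA [x * w1]mulrC -ew e exprS; ring.
by exists w'; rewrite ew ew' -mulrA exprSr.
Qed.

(** A vector from which x could be extracted forever would vanish by Nakayama, and f does not. *)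
Lemma xpow_factor x n (f : 'cV[R]_n) i0 : m x -> f i0 0 <> 0 ->
  exists e (f' : 'cV_n) i, f = x ^+ e *: f' /\ ~ add1 zero x (f' i 0).
Proof.
move=> mx nf; apply: NNPP => bad.
have sz : is_submod (eq^~ 0 : 'rV[R]_n -> Prop).
  by split=> // [v w -> ->|r v ->]; rewrite ?addr0 ?scaler0.
have [||u [nu e]] := @nakayama R 'rV[R]_n m x (eq^~ 0) (fun d => d <> 0 /\
   ~ exists e (f' : 'cV_n) i, d^T = x ^+ e *: f' /\ ~ add1 zero x (f' i 0))
   (noeth_rV noethR) pm mx sz _ f^T.
- move=> d [nd bd].
  have dx j : exists b, d 0 j = b * x.
    apply: NNPP => no; apply: bd; exists 0%N, d^T, j; rewrite expr0 scale1r mxE; split=> //.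
    by move=> [b /eqP]; rewrite subr_eq0 => /eqP e; apply: no; exists b.
  have [b hb] := fin_all_exists dx.
  have e : d = x *: \row_j b j by apply/rowP => j; rewrite !mxE hb mulrC.
  exists 1, (\row_j b j); split; [exact: prime1| |by rewrite scale1r -e subrr].
  split; first by move=> e'; apply: nd; rewrite e e' scaler0.
  move=> [k [f' [i [e' hi]]]]; apply: bd; exists k.+1, f', i; split=> //.
  by rewrite exprS -scalerA -e' e linearZ.
- rewrite trmxK; split=> // /rowP/(_ i0); rewrite !mxE; exact: nf.
- apply: nf; apply: (dom_mul_eq0 _ (notin_prime_neq0 nu)).
  by have /rowP/(_ i0) := e; rewrite !mxE.
Qed.

(** [F] generates the saturation of (f) by powers of x: [A] writes f through F, [B] brings F back
    into (f) after a fixed power of x, and for nonzero x the last clause is regularity of x modulo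
    (F). *)
Lemma x_saturate x n (f : 'cV[R]_n) :
  exists p (F : 'cV[R]_p) (A : 'M_(n, p)) N (B : 'M_(p, n)),
   [/\ f = A *m F, x ^+ N *: F = B *m f &
    x <> 0 -> forall (v : 'rV_p) c, (v *m F) 0 0 = c * x ->
      exists w : 'rV_p, v *m F = x *: (w *m F)].
Proof.
have addE (A B : 'M[R]_1) : (A + B) 0 0 = A 0 0 + B 0 0 by rewrite mxE.
have scaleE r (A : 'M[R]_1) : (r *: A) 0 0 = r * A 0 0 by rewrite mxE.
pose I a := exists N (b : 'rV_n), x ^+ N * a = (b *m f) 0 0.
have iI : is_ideal I.
  split.
  - by exists 0%N, 0; rewrite mul0mx mulr0 mxE.
  - move=> a b [N [v e]] [M [w e']]; exists (N + M)%N, (x ^+ M *: v + x ^+ N *: w).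
    by rewrite mulmxDl -!scalemxAl addE !scaleE -e -e' exprD; ring.
  - move=> r a [N [v e]]; exists N, (r *: v).
    by rewrite -scalemxAl scaleE -e mulrCA.
have [s [sI gen]] := noeth_fg noethR iI.
pose F : 'cV[R]_(size s) := \col_i s`_i.
have span a : I a -> exists v : 'rV_(size s), a = (v *m F) 0 0.
  apply: (gen (fun a => exists v : 'rV_(size s), a = (v *m F) 0 0)).
    split; first by exists 0; rewrite mul0mx mxE.
    - by move=> _ _ [v ->] [w ->]; exists (v + w); rewrite mulmxDl addE.
    - by move=> r _ [v ->]; exists (r *: v); rewrite -scalemxAl scaleE.
  move=> b /(nthP 0)[i lt <-]; exists (delta_mx 0 (Ordinal lt)).
  by rewrite -rowE !mxE.
have FI i : exists Nb : nat * 'rV_n, x ^+ Nb.1 * F i 0 = (Nb.2 *m f) 0 0.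
  rewrite mxE; have [|N [b e]] := sI s`_i; first exact: mem_nth.
  by exists (N, b).
have [Nb hNb] := fin_all_exists FI.
have fI i : exists v : 'rV_(size s), f i 0 = (v *m F) 0 0.
  by apply: span; exists 0%N, (delta_mx 0 i); rewrite expr0 mul1r -rowE mxE.
have [A hA] := fin_all_exists fI.
exists (size s), F, (\matrix_i A i), (\sum_i (Nb i).1)%N,
  (\matrix_i (x ^+ (\sum_(j | j != i) (Nb j).1)%N *: (Nb i).2)); split.
- by apply/colP => i; rewrite hA -(rowK A i) -row_mul [LHS]mxE.
- apply/colP => i; rewrite [LHS]mxE.
  have -> : ((\matrix_i (x ^+ (\sum_(j | j != i) (Nb j).1)%N *: (Nb i).2)) *m f) i 0 =
    x ^+ (\sum_(j | j != i) (Nb j).1)%N * ((Nb i).2 *m f) 0 0.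
    by rewrite -scaleE scalemxAl -(rowK (fun i => _ *: (Nb i).2) i) -row_mul [RHS]mxE.
  by rewrite -hNb mulrA -exprD (bigD1 i) //= addnC.
- move=> nx v c e.
  have [w hw] : exists w : 'rV_(size s), c = (w *m F) 0 0.
    apply: span.
    have [N [b e']] : I ((v *m F) 0 0).
      rewrite mxE; apply: idl_sum => // i _; apply: idlM => //.
      by exists (Nb i).1, (Nb i).2.
    by exists N.+1, b; rewrite -e' e exprSr; ring.
  exists w; apply/matrixP => i j; rewrite !ord1 scaleE -hw e mulrC //.
Qed.

Lemma factor x y z n (f : 'cV_n) i0 :
  prime_flag zero [:: x; y; z] -> generates m zero [:: x; y; z] -> f i0 0 <> 0 ->
  exists s (h : 'cV_n) u, [/\ ~ m u, u *: f = s *: h & grade2 (entries h)].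
Proof.
move=> flag gen nf.
have mx : m x by case: gen => _ + _; apply; rewrite mem_head.
have HB p (F : 'cV_p) i : F i 0 <> 0 ->
   (forall (v : 'rV_p) c, (v *m F) 0 0 = c * x -> exists w : 'rV_p, v *m F = x *: (w *m F)) ->
   exists s (h : 'cV_p) u, [/\ ~ m u, u *: F = s *: h & grade2 (entries h)].
  move=> nF xsat; have [r [g hg]] := syz_basis flag gen xsat.
  exact: (hilbert_burch nF hg).
have [x0|nx] := classic (x = 0).
  apply: (HB _ _ i0) => // v c e; exists 0; apply/matrixP => i j.
  by rewrite !ord1 e x0 mulr0 scale0r mxE.
have p1 : is_prime_ideal (add1 zero x) by case: flag => _ [].
have iq := prime_idl p1.
have xm a : add1 zero x a -> m a by apply: add1_min => // b ->; apply: idl0.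
(* Extracting x^e first leaves an entry of f' outside (x). The same entry of A H is then outside (x)
   too, which allows x^N to be cancelled at the end. *)
have [e [f' [i1 [ff' nf']]]] := xpow_factor mx nf.
have [p [F [A [N [B [f'A xF xsat]]]]]] := x_saturate x f'.
have [j1 nF] : exists j, F j 0 <> 0.
  apply: NNPP => no; apply: nf'; rewrite f'A mxE; apply: idl_sum => // j _.
  apply: idlM => //; suff -> : F j 0 = 0 by apply: idl0.
  by apply: NNPP => h; apply: no; exists j.
have [s [H [u [nu uF grH]]]] := HB _ _ _ nF (xsat nx).
exists (x ^+ e * s), (A *m H), u.
have uf' : u *: f' = s *: (A *m H) by rewrite f'A scalemxAr uF -scalemxAr.
split=> //; first by rewrite -scalerA -uf' ff' !scalerA mulrC.
have ns : s <> 0.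
  move=> s0; apply: nF; apply: (dom_mul_eq0 _ (notin_prime_neq0 nu)).
  by have /colP/(_ j1) := uF; rewrite s0 scale0r !mxE.
have xH : x ^+ N *: H = B *m (A *m H).
  apply/colP => j; apply: (dom_mulfI ns).
  have /colP/(_ j) : s *: (x ^+ N *: H) = s *: (B *m (A *m H)).
    by rewrite scalerA [s * _]mulrC -scalerA -uF scalemxAr -uf' -scalemxAr -xF !scalerA mulrC.
  by rewrite [LHS]mxE [RHS]mxE.
have nh : ~ add1 zero x ((A *m H) i1 0).
  move=> hx; have : add1 zero x (u * f' i1 0).
    have /colP/(_ i1) := uf'; rewrite [LHS]mxE [RHS]mxE => ->; exact: idlM.
  have [_ _ pM] := p1; by case/pM => // /xm.
(* Grade two passes from H to A H: x^N H lies in the span of A H, so c divides t x^N up to a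
   multiplier, with quotient w; the entry of A H outside (x) shows that x^N divides w. *)
move=> c t nc hc.
have [|v [nv [w e1]]] := grH c (t * x ^+ N) nc.
  move=> _ [j ->]; have /colP/(_ j) := xH; rewrite [LHS]mxE -mulrA => ->.
  rewrite mxE mulr_sumr; apply: idl_sum; first exact: saturation_princ_idl.
  move=> k _; rewrite mulrCA; apply: idlM; first exact: saturation_princ_idl.
  by apply: hc; exists k.
have [|v' [nv' [w' e2]]] := hc ((A *m H) i1 0); first by exists i1.
have [||w'' e3] := @xpow_cancel x N (v' * (A *m H) i1 0) w (v * w') p1 nx.
- by apply: primeM => // /xm.
- apply: (dom_mulfI nc).
  transitivity (v' * (A *m H) i1 0 * (w * c)); first by ring.
  rewrite -e1; transitivity (v * (v' * (t * (A *m H) i1 0)) * x ^+ N); first by ring.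
  by rewrite e2; ring.
exists v; split=> //; exists w''.
have nxN : x ^+ N <> 0.
  by elim: N {xF xH e1 e2 e3} => [|N IH]; rewrite ?expr0 ?exprS;
    [apply/eqP; rewrite oner_eq0|move=> /dom_mul_eq0 h; apply: IH; apply: h].
by apply: (dom_mulfI nxN); rewrite mulrC -mulrA e1 e3; ring.
Qed.

End Factor.

(** * Associated primes, depth and powers of principal ideals *)

Section Depth.
Variable R : comNzRingType.
Hypothesis noethR : noetherian R.
Implicit Types (I J P Q m : R -> Prop).

Lemma prime_prod P (T : eqType) (s : seq T) (F : T -> R) :
  is_prime_ideal P -> P (\prod_(t <- s) F t) -> exists2 t, t \in s & P (F t).
Proof.
move=> pP; elim: s => [|a s IH]; first by rewrite big_nil => /(prime1 pP).
rewrite big_cons; have [_ _ pM] := pP; case/pM; first by exists a => //; rewrite mem_head.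
by move=> /IH[t ts Pt]; exists t => //; rewrite in_cons ts orbT.
Qed.

Lemma prime_avoidance I n (Pf : nat -> R -> Prop) : is_ideal I ->
  (forall i, (i < n)%N -> is_prime_ideal (Pf i) /\ ~ forall a, I a -> Pf i a) ->
  exists a, I a /\ forall i, (i < n)%N -> ~ Pf i a.
Proof.
move=> iI; elim: n Pf => [|n IH] Pf hP; first by exists 0; split=> //; apply: idl0.
case: n IH hP => [_|n IH] hP.
  have [_ /not_all_ex_not[a ha]] := hP 0%N isT.
  have [Ia nPa] := imply_to_and _ _ ha; exists a; split=> // i.
  by rewrite ltnS leqn0 => /eqP->.
apply: NNPP => no.
(* Skipping the i-th prime by [bump], induction gives a_i outside all the others; were a_i also
   outside the i-th one, it would be the answer. The element used in the end is a_0 plus the product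
   of the other a_i. *)
have avoid i : exists a, (i < n.+2)%N -> I a /\ forall j, (j < n.+2)%N -> j != i -> ~ Pf j a.
  have [j|a [Ia ha]] := IH (fun j => Pf (bump i j)).
    by move=> jn; apply: hP; rewrite /bump; case: (leqP i j) => _ /=; [rewrite add1n|rewrite add0n; apply: leqW].
  exists a => lt; split=> // j jn ji; have := ha (unbump i j); rewrite unbumpKcond (negbTE ji).
  apply; rewrite /unbump; case: (ltnP i j) => ij; first by case: j jn ij {ji} => // j; rewrite subn1.
  by rewrite subn0; move: ij; rewrite leq_eqVlt (negbTE ji) => /leq_trans; apply.
have [a ha] := choice _ avoid.
have aP i : (i < n.+2)%N -> Pf i (a i).
  move=> lt; apply: NNPP => nP; apply: no; exists (a i); have [Ia h] := ha i lt.
  by split=> // j jn; have [->|/(h j jn)] := eqVneq j i.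
apply: no; exists (a 0%N + \prod_(i <- iota 1 n.+1) a i); split.
  apply: idlD => //; first by case: (ha 0%N isT).
  by rewrite /= big_cons; apply: idlMr => //; case: (ha 1%N isT).
move=> i lt hi; have [pPi _] := hP i lt; have iP := prime_idl pPi.
have [i0|i0] := eqVneq i 0%N.
  have [j] : exists2 j, j \in iota 1 n.+1 & Pf i (a j).
    apply: (prime_prod pPi); rewrite -[X in Pf i X](addKr (a 0%N)) addrC.
    by apply: idlB => //; rewrite i0; apply: aP.
  rewrite mem_iota => /andP[j0 jn]; have [_ /(_ i lt) h] := ha j jn; apply: h.
  by rewrite i0 eq_sym -lt0n.
have [_ /(_ i lt i0)] := ha 0%N isT; apply.
rewrite -[X in Pf i X](addrK (\prod_(i <- iota 1 n.+1) a i)); apply: idlB => //.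
rewrite (bigD1_seq i) ?iota_uniq ?mem_iota ?lt0n ?i0 //=.
by apply: idlMr => //; apply: aP.
Qed.

Definition max_annihilator Q y := ~ Q y /\ forall y', ~ Q y' ->
  (forall r, colon Q y r -> colon Q y' r) -> forall r, colon Q y' r -> colon Q y r.

Lemma max_annihilator_prime Q y :
  is_ideal Q -> max_annihilator Q y -> is_prime_ideal (colon Q y).
Proof.
move=> iQ [nQ maxy]; split; [exact: colon_idl|by rewrite /colon mul1r|].
move=> a b Qab; have [Qa|na] := classic (Q (a * y)); [by left|right].
apply: (maxy _ na); first by move=> r; rewrite /colon mulrCA; apply: idlM.
by move: Qab; rewrite /colon mulrA [b * a]mulrC.
Qed.

(** The ideal generated by all elements with maximal annihilator is generated by finitely many of
    them, [ys]. If a maximal annihilator Q : y' contained no Q : z with z in [ys], a product of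
    elements t_z of Q : z outside Q : y' would kill all of [ys], hence y', against the primality of
    Q : y'. *)
Lemma zero_divisors Q : is_ideal Q -> exists ys : seq R,
  (forall y, y \in ys -> max_annihilator Q y) /\
  forall r y, Q (r * y) -> ~ Q y -> exists2 y', y' \in ys & Q (r * y').
Proof.
move=> iQ; pose G := gen_ideal (max_annihilator Q).
have [s [sG gen]] := noeth_fg noethR (gen_ideal_idl (max_annihilator Q)).
have [ys [ysM ysG]] : exists ys : seq R, (forall y, y \in ys -> max_annihilator Q y) /\
    forall J, is_ideal J -> (forall y, y \in ys -> J y) -> forall a, a \in s -> J a.
  elim: s sG {gen} => [|a s IH] sG; first by exists [::].
  have [|ys [h1 h2]] := IH; first by move=> b bs; apply: sG; rewrite in_cons bs orbT.
  have [l [lM ->]] := sG a (mem_head _ _).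
  exists ([seq p.2 | p <- l] ++ ys); split.
    by move=> y; rewrite mem_cat => /orP[/mapP[p /lM ? ->]|/h1].
  move=> J iJ hJ b; rewrite in_cons => /orP[/eqP->|bs].
    apply: idl_sum => // p pl; apply: idlM => //; apply: hJ.
    by rewrite mem_cat; apply/orP; left; apply/mapP; exists p.
  by apply: h2 bs => // y yys; apply: hJ; rewrite mem_cat yys orbT.
exists ys; split=> // r y Qry nQy.
have [||y' [nQy' sub] maxy'] := @noeth_maximal R R^o R
   (fun y' => ~ Q y' /\ forall r, colon Q y r -> colon Q y' r) (colon Q) y
   (noeth_reg noethR).
- by [].
- by move=> t _; apply: colon_idl.
have My' : max_annihilator Q y'.
  split=> // z nQz subz; apply: maxy' => //; split=> // t /sub; exact: subz.
have py' := max_annihilator_prime iQ My'.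
have [z zys subz] : exists2 z, z \in ys & forall t, colon Q z t -> colon Q y' t.
  apply: NNPP => no.
  have h z : exists t, z \in ys -> colon Q z t /\ ~ colon Q y' t.
    have [zys|] := boolP (z \in ys); last by exists 0.
    apply: NNPP => no'; apply: no; exists z => // t Qt.
    by apply: NNPP => nt; apply: no'; exists t.
  have [t ht] := choice _ h.
  have [|z zys] := prime_prod (s := ys) (F := t) py'; last by case: (ht z zys).
  rewrite /colon mulrC; apply: (gen (colon Q (\prod_(z <- ys) t z))).
  - exact: colon_idl.
  - apply: ysG; first exact: colon_idl.
    move=> z zys; rewrite /colon (big_rem z) //= mulrA; apply: idlMr => //.
    by rewrite mulrC; case: (ht z zys).
  - exact: gen_ideal_in.
exists z => //; have [nQz maxz] := ysM z zys.
by apply: (maxz _ nQy' subz); apply: sub.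
Qed.

Lemma ass_ext Q Q' P P' : (forall x, Q x <-> Q' x) -> (forall x, P x <-> P' x) ->
  ass_quot Q P -> ass_quot Q' P'.
Proof.
move=> eQ eP [pP [x hx]]; split; first exact: (prime_ext eP).
by exists x => r; rewrite -eP -eQ; apply: hx.
Qed.

Lemma span_seq_nil (r : R) : span_seq [::] r <-> r = 0.
Proof.
split; last by move=> ->; apply: idl0; apply: gen_ideal_idl.
move=> [l [hl ->]]; rewrite big_seq big1 // => p /hl; by rewrite in_nil.
Qed.

Lemma span_seq_rcons s (a r : R) : span_seq (rcons s a) r <-> add1 (span_seq s) a r.
Proof.
have iS t : is_ideal (span_seq t) by apply: gen_ideal_idl.
split.
  apply: gen_ideal_sub; first exact: add1_idl.
  move=> x; rewrite mem_rcons in_cons => /orP[/eqP->|xs]; first exact: add1_in.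
  by apply: add1_sub; apply: gen_ideal_in.
apply: add1_min => //; last by apply: gen_ideal_in; rewrite mem_rcons mem_head.
apply: gen_ideal_sub => // x xs; apply: gen_ideal_in.
by rewrite mem_rcons in_cons xs orbT.
Qed.

Lemma add_nil Q r : ideal_add Q (span_seq [::]) r <-> Q r.
Proof.
split; first by move=> [a [b [Qa [/span_seq_nil-> ->]]]]; rewrite addr0.
by move=> Qr; exists r, 0; rewrite addr0; split=> //; split=> //; apply/span_seq_nil.
Qed.

Lemma add_rcons Q s a r : ideal_add Q (span_seq (rcons s a)) r <->
  exists c, ideal_add Q (span_seq s) (r - c * a).
Proof.
split.
  move=> [q [b [Qq [/span_seq_rcons[c hc] ->]]]]; exists c, q, (b - c * a).
  by rewrite addrA.
move=> [c [q [b [Qq [sb e]]]]]; exists q, (b + c * a); split=> //; split.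
  by apply/span_seq_rcons; exists c; rewrite addrK.
by rewrite addrA -e subrK.
Qed.

Lemma depth_ext m Q Q' n : (forall x, Q x <-> Q' x) -> depth_ge m Q n -> depth_ge m Q' n.
Proof.
move=> e [s [sz h]]; exists s; split=> // i lt; have [mi hi] := h i lt; split=> // r.
have ee t : ideal_add Q (span_seq (take i s)) t <-> ideal_add Q' (span_seq (take i s)) t.
  by split=> -[a [b [/e Qa hb]]]; exists a, b.
by move=> /ee/hi/ee.
Qed.

Lemma depth_ge0 m Q : depth_ge m Q 0.
Proof. by exists [::]. Qed.

(** Saturation puts every proper annihilator inside m, so a maximal annihilator containing m would
    make m associated. Otherwise prime avoidance finds an element of m outside the finitely many
    that contain all zero divisors. *)
Lemma depth_ge1 m Q : is_prime_ideal m -> is_ideal Q -> saturated m Q ->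
  depth_ge m Q 1 <-> ~ ass_quot Q m.
Proof.
move=> pm iQ satQ; split.
  move=> [[|a [|? ?]] [//= _ h]]; have {h} [ma ha] := h 0%N isT.
  move=> [_ [x hx]]; have Qx : Q x.
    by apply/add_nil/ha/add_nil; apply/hx.
  by apply: (prime1 pm); apply/hx; rewrite mul1r.
move=> nass; have [ys [ysM zd]] := zero_divisors iQ.
have [i lt|a [ma ha]] := @prime_avoidance m (size ys) (fun i => colon Q ys`_i) (prime_idl pm).
  have My := ysM _ (mem_nth 0 lt); split; first exact: max_annihilator_prime.
  move=> sub; apply: nass; split=> //; exists ys`_i => r; split; first exact: sub.
  by move=> Qr; apply: NNPP => nr; case: My => + _; apply; apply: satQ nr Qr.
exists [:: a]; split=> // -[|//] _; split=> // r /add_nil Qar; apply/add_nil.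
apply: NNPP => nQr; have [y /(nthP 0)[i lt <-]] := zd _ _ Qar nQr; exact: ha.
Qed.

End Depth.

(** * Regular sequences and associated primes modulo the powers of one regular element *)

Section PrincipalPowers.
Variables (R : comNzRingType) (s : R).
Hypothesis (regs : forall r, s * r = 0 -> r = 0).

Let level b t : R -> Prop := ideal_add (princ (s ^+ b)) (span_seq t).

Lemma level_idl b t : is_ideal (level b t).
Proof. by apply: ideal_addP; [apply: princ_idl|apply: gen_ideal_idl]. Qed.

Lemma level_le a b t r : (a <= b)%N -> level b t r -> level a t r.
Proof.
move=> /subnK <- [_ [w [[v ->] [hw ->]]]]; exists (v * s ^+ (b - a) * s ^+ a), w.
by split; [eexists|rewrite exprD mulrA].
Qed.

Lemma span_level b t r : span_seq t r -> level b t r.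
Proof. by move=> h; exists 0, r; rewrite add0r; split=> //; exists 0; rewrite mul0r. Qed.

Lemma pow_level b t r : level b t (r * s ^+ b).
Proof.
exists (r * s ^+ b), 0; rewrite addr0; split; first by exists r.
by split=> //; apply: idl0; apply: gen_ideal_idl.
Qed.

(** The first conclusion says that multiplication by s^a still embeds R/(s^b) in R/(s^(a+b)) modulo
    the first i elements. It is carried through the induction because it supplies the filtration:
    regularity at level K descends to level 1 and climbs from there to every level. *)
Lemma levels_regular K xs : (0 < K)%N ->
  (forall i, (i < size xs)%N -> forall r,
     level K (take i xs) (nth 0 xs i * r) -> level K (take i xs) r) ->
  forall i, (i <= size xs)%N ->
   (forall a b r, level (a + b) (take i xs) (s ^+ a * r) -> level b (take i xs) r) /\
   ((i < size xs)%N -> forall a r,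
     level a (take i xs) (nth 0 xs i * r) -> level a (take i xs) r).
Proof.
move=> K0 hK.
(* R / (s^a) is filtered by copies of R / (s), so regularity of one element passes between levels. *)
have step i : (i < size xs)%N ->
   (forall a b r, level (a + b) (take i xs) (s ^+ a * r) -> level b (take i xs) r) ->
   forall a r, level a (take i xs) (nth 0 xs i * r) -> level a (take i xs) r.
  move=> lt C; have reg1 r : level 1 (take i xs) (nth 0 xs i * r) -> level 1 (take i xs) r.
    move=> [_ [w [[v ->] [hw e]]]]; apply: (C K.-1); rewrite addn1 prednK //.
    apply: hK => //; rewrite mulrCA e mulrDr.
    apply: idlD; [exact: level_idl| |apply: idlM; [exact: level_idl|exact: span_level]].
    rewrite mulrCA -exprD addn1 prednK //; exact: pow_level.
  elim=> [|a IH] r h; first by rewrite -[r]mulr1 -(expr0 s); apply: pow_level.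
  have [_ [w [[v ->] [hw er]]]] := IH r (level_le (leqnSn a) h).
  have /C/reg1[_ [w' [[v' ->] [hw' ev]]]] : level (a + 1) (take i xs) (s ^+ a * (nth 0 xs i * v)).
    have -> : s ^+ a * (nth 0 xs i * v) = nth 0 xs i * r - nth 0 xs i * w by rewrite er; ring.
    rewrite addn1; apply: idlB => //; first exact: level_idl.
    by apply: idlM; [exact: level_idl|exact: span_level].
  have -> : r = v' * s ^+ a.+1 + (s ^+ a * w' + w) by rewrite er ev expr1 exprS; ring.
  apply: idlD; [exact: level_idl|exact: pow_level|].
  apply: idlD; [exact: level_idl| |exact: span_level].
  by apply: idlM; [exact: level_idl|exact: span_level].
suff C i : (i <= size xs)%N -> forall a b r,
    level (a + b) (take i xs) (s ^+ a * r) -> level b (take i xs) r.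
  by move=> i le; split=> [|lt]; [exact: C|exact: (step _ lt (C i le))].
elim: i => [_|i IH lt] a b r.
  rewrite take0 => /add_nil[v e]; apply/add_nil; exists v.
  apply/eqP; rewrite -subr_eq0; apply/eqP.
  have : s ^+ a * (r - v * s ^+ b) = 0 by rewrite mulrBr e exprD; ring.
  by elim: a {e} => [|a IHa]; rewrite ?expr0 ?mul1r // exprS -mulrA => /regs.
have C := IH (ltnW lt).
rewrite (take_nth 0 lt) => /add_rcons[c [_ [w [[v ->] [hw e]]]]].
have /(step _ lt C)[_ [w' [[c' ->] [hw' ec]]]] : level a (take i xs) (nth 0 xs i * c).
  have -> : nth 0 xs i * c = (r - v * s ^+ b) * s ^+ a - w.
    have -> : w = s ^+ a * r - c * nth 0 xs i - v * s ^+ (a + b) by rewrite e; ring.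
    by rewrite exprD; ring.
  apply: idlB; [exact: level_idl|exact: pow_level|exact: span_level].
apply/add_rcons; exists c'.
have -> : r - c' * nth 0 xs i = v * s ^+ b + (r - v * s ^+ b - c' * nth 0 xs i) by ring.
apply: idlD; [exact: level_idl|exact: pow_level|].
apply: (C a); apply: span_level.
have -> : s ^+ a * (r - v * s ^+ b - c' * nth 0 xs i) = w + nth 0 xs i * w'.
  have -> : w = s ^+ a * r - c * nth 0 xs i - v * s ^+ (a + b) by rewrite e; ring.
  by rewrite ec exprD; ring.
by apply: idlD; [exact: gen_ideal_idl| |apply: idlM => //; exact: gen_ideal_idl].
Qed.

Lemma depth_princ_pow m k l n : (0 < k)%N ->
  depth_ge m (princ (s ^+ k)) n -> depth_ge m (princ (s ^+ l)) n.
Proof.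
move=> k0 [xs [sz h]]; exists xs; split=> // i lt; have [mi _] := h i lt; split=> //.
have [|_ reg] := @levels_regular k xs k0 _ i (ltnW lt); last exact: reg.
by move=> j /h[].
Qed.

Lemma ass_princ_pow P k : (0 < k)%N ->
  ass_quot (princ (s ^+ k)) P <-> ass_quot (princ s) P.
Proof.
have regX j r : s ^+ j * r = 0 -> r = 0.
  by elim: j => [|j IH]; rewrite ?expr0 ?mul1r // exprS -mulrA => /regs.
have canX j a b : s ^+ j * a = s ^+ j * b -> a = b.
  move=> e; apply/eqP; rewrite -subr_eq0; apply/eqP; apply: (@regX j).
  by rewrite mulrBr e subrr.
case: k => // k _; split; last first.
  move=> [pP [x hx]]; split=> //; exists (s ^+ k * x) => r; rewrite hx; split.
    by move=> [v e]; exists v; rewrite mulrCA e exprS; ring.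
  move=> [v e]; exists v; apply: (@canX k).
  by rewrite mulrCA e exprS; ring.
elim: k => [|k IH]; first by rewrite expr1.
move=> [pP [x hx]].
have [_ _ pM] := pP.
(* If some r outside P sends x into (s), then r x / s has annihilator P modulo the next lower power;
   otherwise P is already the annihilator of x modulo s. *)
have [[r [nPr [w e]]]|no] := classic (exists r, ~ P r /\ princ s (r * x)).
  apply: IH; split=> //; exists w => t.
  have -> : P t <-> P (t * r).
    split=> [|/pM[]//]; apply: idlMr; exact: prime_idl.
  rewrite hx -mulrA e.
  split=> [[v h]|[v h]]; exists v; last by rewrite mulrA h -mulrA -exprSr.
  by apply: (@canX 1%N); rewrite expr1 mulrC -mulrA h exprSr; ring.
split=> //; exists x => r; split.
  by move=> /hx[v ->]; exists (v * s ^+ k.+1); rewrite exprSr mulrA.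
by move=> h; apply: NNPP => nPr; apply: no; exists r.
Qed.

End PrincipalPowers.

(** * Ideals of the form s J with J of grade two *)

Section IdealPowers.
Variable R : comNzRingType.
Implicit Types (I J P : R -> Prop).

Lemma ideal_pow_idl I k : is_ideal (ideal_pow I k).
Proof. exact: gen_ideal_idl. Qed.

Lemma ideal_pow_prod I (l : seq R) :
  (forall a, a \in l -> I a) -> ideal_pow I (size l) (\prod_(a <- l) a).
Proof. by move=> hl; apply: gen_ideal_in; exists l. Qed.

Lemma ideal_pow_min I J k : is_ideal J ->
  (forall l : seq R, size l = k -> (forall a, a \in l -> I a) -> J (\prod_(a <- l) a)) ->
  forall x, ideal_pow I k x -> J x.
Proof. by move=> iJ h; apply: gen_ideal_sub => // x [l [sz [hl ->]]]; apply: h. Qed.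

Lemma ideal_pow_prime I P k : is_prime_ideal P -> (0 < k)%N ->
  (forall x, ideal_pow I k x -> P x) <-> (forall x, I x -> P x).
Proof.
move=> pP k0; split=> h x.
  move=> Ix; have : P (\prod_(a <- nseq k x) a).
    by apply: h; rewrite -{1}(size_nseq k x); apply: ideal_pow_prod => a /nseqP[->].
  by case/(prime_prod pP) => a /nseqP[->].
apply: ideal_pow_min => //; first exact: prime_idl.
case=> [sz|a l _ hl]; first by rewrite -sz in k0.
by rewrite big_cons; apply: idlMr; [exact: prime_idl|apply/h/hl; rewrite mem_head].
Qed.

Lemma ideal_pow_ext I J k : (forall x, I x <-> J x) ->
  forall x, ideal_pow I k x <-> ideal_pow J k x.
Proof.
move=> e x; split; apply: ideal_pow_min; try exact: ideal_pow_idl;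
  by move=> l <- hl; apply: ideal_pow_prod => a /hl /e.
Qed.

Lemma ideal_pow_princ (s : R) k x : ideal_pow (princ s) k x <-> princ (s ^+ k) x.
Proof.
split.
  apply: ideal_pow_min; first exact: princ_idl.
  elim: k => [|k IH] [|a l] //=; first by exists 1; rewrite big_nil expr0 mulr1.
  move=> [sz] hl; have [|c e] := IH l sz; first by move=> b bl; apply: hl; rewrite in_cons bl orbT.
  have [c' e'] := hl a (mem_head _ _); exists (c' * c).
  by rewrite big_cons e e' exprS; ring.
move=> [c ->]; apply: idlM; first exact: ideal_pow_idl.
have -> : s ^+ k = \prod_(a <- nseq k s) a by rewrite big_nseq iter_mulr_1.
by rewrite -{1}(size_nseq k s); apply: ideal_pow_prod => a /nseqP[-> _]; exists 1; rewrite mul1r.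
Qed.

End IdealPowers.

(** * Associated primes and depth of s J in dimension at most three *)

Section Height3.
Variables (R : comNzRingType) (m : R -> Prop) (x y z : R).
Hypotheses (noethR : noetherian R) (pm : is_prime_ideal m).
Let zero : R -> Prop := eq^~ 0.
Hypotheses (flag : prime_flag zero [:: x; y; z]) (gen : generates m zero [:: x; y; z]).
Implicit Types (I J P Q : R -> Prop).

Let im := prime_idl pm.
Let domR : is_prime_ideal zero. Proof. by case: flag. Qed.

(** A prime P' containing J has height at least two: a prime annihilator q modulo a nonzero c in J
    lies below P' and, by grade two, does not contain J. A strict inclusion of P' in P would make 0,
    q, P', P, m a chain of length four. *)
Lemma height_two J P P' : grade2 m J -> is_prime_ideal P -> is_prime_ideal P' ->
  (forall r, P r -> m r) -> (exists r, m r /\ ~ P r) ->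
  (forall j, J j -> P' j) -> (forall r, P' r -> P r) -> forall r, P r -> P' r.
Proof.
move=> grJ pP pP' Pm [e [me nPe]] JP' P'P r Pr; apply: NNPP => nP'r.
have zP T : is_prime_ideal T -> forall a, zero a -> T a.
  by move=> pT a ->; apply: idl0; apply: prime_idl.
have [c [Jc nc]] : exists c, J c /\ c <> 0.
  apply: NNPP => no; have [||u [nu [v ev]]] := grJ e 1.
  - by move=> e0; apply: nPe; apply: (zP P).
  - move=> j Jj; suff -> : j = 0 by rewrite mulr0; apply: idl0; apply: saturation_princ_idl.
    by apply: NNPP => nj; apply: no; exists j.
  - by apply: nu; rewrite -[u]mulr1 ev; apply: idlM.
have [|w [pq qP']] := ass_below noethR pP' (princ_idl c).
  by move=> _ [v ->]; apply: idlM; [exact: prime_idl|exact: JP'].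
set q := colon (princ c) w in pq qP'.
have [d [P'd nqd]] : exists d, P' d /\ ~ q d.
  apply: NNPP => no; have [j Jj|u [nu qu]] := grJ c w nc.
    apply: saturation_sub => //; rewrite mulrC.
    by apply: NNPP => nq; apply: no; exists j; split; [exact: JP'|exact: nq].
  by apply: nu; apply/Pm/P'P/qP'.
pose C i := match i with 0 => zero | 1 => q | 2 => P' | 3 => P | _ => m end.
suff : (4 <= size [:: x; y; z])%N by [].
apply: (@height_le _ noethR m zero _ 4 C) => //; first exact: prime_idl.
split; first by case=> [|[|[|[|[|i]]]]].
case=> [|[|[|[|i]]]] //= _; split=> //.
- exact: (zP q).
- exists c; split=> //; exists w; rewrite mulrC //.
- by exists d.
- by exists r.
- by exists e.
Qed.

(* Q = s J after localization at m. *)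
Definition locally_scaled s Q J :=
  [/\ is_ideal Q, is_ideal J, (forall q, Q q -> exists u j, [/\ ~ m u, J j & u * q = s * j]),
      forall j, J j -> Q (s * j) & grade2 m J].

(** [ass_below] and [height_two] make P the annihilator of some w modulo J. Locally, multiplication
    by s embeds R/J in R/Q, so s w has annihilator P modulo Q. *)
Lemma ass_height2 s Q J P : s <> 0 -> locally_scaled s Q J -> saturated m Q ->
  is_prime_ideal P -> (forall r, P r -> m r) -> (exists r, m r /\ ~ P r) ->
  (forall j, J j -> P j) -> exists w, same_set P (colon Q w).
Proof.
move=> ns [iQ iJ QJ JQ grJ] satQ pP Pm mP JP.
have [w [pw wP]] := ass_below noethR pP iJ JP.
have Pw r : P r -> J (r * w).
  apply: (height_two grJ pP pw) => // j Jj; rewrite /colon mulrC; exact: idlM.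
exists (s * w) => r; split.
  by move=> /Pw /JQ; rewrite /colon mulrCA.
move=> /QJ[u [j [nu Jj e]]]; have [_ _ pM] := pP.
have : P (u * r).
  apply: wP; rewrite /colon; suff -> : u * r * w = j by [].
  apply: (dom_mulfI domR ns); rewrite -e; ring.
by case/pM => // /Pm.
Qed.

(** Read up to multipliers, this follows 0 -> R/J -> R/sJ -> R/(s) -> 0. An associated prime of (s)
    inside m cannot contain J, of grade two, so its witness can be multiplied by an element of J
    outside P. *)
Lemma ass_locally_scaled s Q J P : s <> 0 -> locally_scaled s Q J -> saturated m Q ->
  is_prime_ideal P -> (exists r, m r /\ ~ P r) ->
  ass_quot Q P <->
  (forall r, P r -> m r) /\ (ass_quot (princ s) P \/ forall j, J j -> P j).
Proof.
move=> ns sc satQ pP mP; have [iQ iJ QJ JQ grJ] := sc; have [_ _ pM] := pP.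
have iP := prime_idl pP.
split; last first.
  move=> [Pm [|JP]]; last first.
    by split=> //; exact: (ass_height2 ns sc).
  move=> [_ [w hw]].
  have [j [Jj nPj]] : exists j, J j /\ ~ P j.
    apply: NNPP => no; have [j Jj|u [nu su]] := grJ s w ns.
      apply: saturation_sub => //; rewrite mulrC; apply/hw.
      by apply: NNPP => nP; apply: no; exists j.
    by apply/nu/Pm/hw.
  split=> //; exists (j * w) => r; split.
    move=> /hw[v e]; have -> : r * (j * w) = s * (v * j) by rewrite mulrCA e; ring.
    by apply: JQ; apply: idlM.
  move=> /QJ[u [j' [nu Jj' e]]].
  have : P (u * r * j).
    apply/hw; exists j'; rewrite [j' * s]mulrC -e; ring.
  by case/pM => // /pM[/Pm|].
move=> [_ [w hw]].
have nQw : ~ Q w by move=> Qw; apply: (prime1 pP); apply/hw; rewrite mul1r.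
have Pm r : P r -> m r.
  by move=> /hw Qr; apply: NNPP => nr; apply: nQw; apply: satQ nr Qr.
split=> //.
(* s J lies in Q, so J kills w' modulo Q as soon as w' is in (s) up to a multiplier. *)
have inJ w' : saturation m (princ s) w' -> (forall r, Q (r * w') -> P r) ->
    forall j, J j -> P j.
  move=> [u [nu [v e]]] h j Jj.
  have : P (u * j).
    apply: h; have -> : u * j * w' = v * (s * j) by rewrite mulrAC e; ring.
    by apply: idlM => //; apply: JQ.
  by case/pM => // /Pm.
pose A r := saturation m (princ s) (r * w).
(* If some r outside P brings w into (s), then P is still the annihilator of r w modulo Q and [inJ]
   applies. Otherwise exactly the elements of P bring w into (s) up to multipliers, and one
   multiplier u serves all of P. *)
have [[r [nPr Ar]]|no] := classic (exists r, ~ P r /\ A r).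
  right; apply: (inJ _ Ar) => t; rewrite mulrA => /hw /pM[]//.
have PA r : P r -> A r.
  by move=> /hw /QJ[u [j [nu Jj e]]]; exists u; split=> //; exists j; rewrite e mulrC.
have [|u [nu hu]] := @common_mult R m P (colon (princ s) w) noethR pm iP (colon_idl w (princ_idl s)).
  by move=> r /PA[u [nu h]]; exists u; rewrite /colon -mulrA.
left; split=> //; exists (u * w) => r; split.
  by move=> /hu; rewrite /colon mulrCA -mulrA.
move=> h; apply: NNPP => nPr; apply: no; exists r; split=> //.
by exists u; split=> //; move: h; rewrite mulrCA.
Qed.

(* Depth at least 2 would give b in m regular modulo Q + (a); but m is associated to Q + (a). *)
Lemma depth_lt2 s Q J n : s <> 0 -> locally_scaled s Q J -> saturated m Q ->
  (forall j, J j -> m j) -> ~ depth_ge m Q n.+2.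
Proof.
move=> ns sc satQ Jm [[|a [|b xs]] [//= _ h]]; have [iQ iJ QJ JQ grJ] := sc.
have [ma ha] := h 0%N isT; have [mb hb] := h 1%N isT; rewrite /= in ma ha mb hb.
have {}ha r : Q (a * r) -> Q r by move=> /add_nil/ha/add_nil.
have {}hb r : add1 Q a (b * r) -> add1 Q a r.
  have e t : ideal_add Q (span_seq [:: a]) t <-> add1 Q a t.
    by rewrite (add_rcons Q [::] a t); split=> -[c /add_nil hc]; exists c => //; apply/add_nil.
  by move=> /e/hb/e.
(* The ideal Q : J contains s. If it lay in Q + (a) up to multipliers, regularity of a and Nakayama
   would put a multiple of s by an element outside m into Q, and then J would leave m. *)
pose M t := forall j, J j -> Q (t * j).
have Ms : M s by move=> j /JQ.
have [t Mt nt] : exists2 t, M t & forall u, ~ m u -> ~ add1 Q a (u * t).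
  apply: NNPP => no.
  have [v Mv|u [nu Qu]] := nakayama_ideal (M := M) noethR pm ma iQ _ Ms.
    have [u [nu [c hc]]] : exists u, ~ m u /\ add1 Q a (u * v).
      apply: NNPP => no'; apply: no; exists v => // u nu hu; apply: no'; by exists u.
    exists u, c; split=> //; last by rewrite [a * c]mulrC.
    move=> j Jj; apply: ha.
    have -> : a * (c * j) = u * (v * j) - (u * v - c * a) * j by ring.
    by apply: idlB => //; [apply: idlM => //; apply: Mv|apply: idlMr].
  have [u' [j [nu' Jj e]]] := QJ _ Qu.
  apply: (primeM pm nu' nu); apply: Jm; suff -> : u' * u = j by [].
  by apply: (dom_mulfI domR ns); rewrite -e; ring.
have ia : is_ideal (add1 Q a) by apply: add1_idl.
have [|r [pP Pm]] := ass_below noethR pm (colon_idl t ia).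
  by move=> u hu; apply: NNPP => /nt; apply.
set P := colon _ r in pP Pm.
have JP j : J j -> P j.
  move=> Jj; rewrite /P /colon mulrAC; apply: idlMr => //.
  rewrite mulrC; apply: add1_sub; exact: Mt.
have Pa : P a.
  by rewrite /P /colon -mulrA mulrC; apply: idlM => //; apply: add1_in.
have nP1 := prime1 pP.
(* If P were not all of m, [ass_height2] would make it associated to Q, although it contains the
   regular element a. So P contains b, which is regular modulo Q + (a). *)
have [[c [mc nPc]]|no] := classic (exists c, m c /\ ~ P c).
  have [|w hw] := ass_height2 ns sc satQ pP Pm _ JP; first by exists c.
  by apply: nP1; apply/hw; rewrite /colon mul1r; apply/ha/hw.
have Pb : P b by apply: NNPP => nPb; apply: no; exists b.
apply: nP1; rewrite /P /colon mul1r; apply: hb.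
by move: Pb; rewrite /P /colon mulrA.
Qed.

End Height3.

(** * Associated primes and depth of powers *)

Section Powers.
Variables (R : comNzRingType) (m : R -> Prop).
Hypothesis pm : is_prime_ideal m.

Lemma grade2_pow J k : grade2 m J -> grade2 m (ideal_pow J k).
Proof.
move=> gr c t nc hc.
have : forall l : seq R, size l = k -> (forall a, a \in l -> J a) ->
    saturation m (princ c) (t * \prod_(a <- l) a).
  by move=> l sz hl; apply: hc; rewrite -sz; apply: ideal_pow_prod.
elim: k t {hc} => [|k IH] t hc; first by have := hc [::]; rewrite big_nil mulr1; apply.
apply: gr => // j Jj; apply: IH => l sz hl.
have := hc (j :: l); rewrite big_cons mulrA; apply=> [|a]; rewrite /= ?sz // in_cons.
by move=> /orP[/eqP->|/hl].
Qed.

Lemma locally_scaled_pow s Q J k :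
  locally_scaled m s Q J -> locally_scaled m (s ^+ k) (ideal_pow Q k) (ideal_pow J k).
Proof.
move=> [iQ iJ QJ JQ gr]; split; try exact: ideal_pow_idl; last exact: grade2_pow.
- apply: ideal_pow_min.
    have i k' := ideal_pow_idl J k'.
    split.
    + by exists 1, 0; rewrite !mulr0; split; [exact: prime1|exact: idl0|].
    + move=> a b [u [j [nu Jj e]]] [u' [j' [nu' Jj' e']]].
      exists (u * u'), (u' * j + u * j'); split; first exact: primeM.
        by apply: idlD => //; apply: idlM.
      have -> : u * u' * (a + b) = u' * (u * a) + u * (u' * b) by ring.
      by rewrite e e'; ring.
    + move=> r a [u [j [nu Jj e]]]; exists u, (r * j); split=> //; first exact: idlM.
      by rewrite mulrCA e; ring.
  move=> l <- hl.
  suff [u [l' [nu sz hl' e]]] : exists u l', [/\ ~ m u, size l' = size l,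
      forall a, a \in l' -> J a &
      u * \prod_(a <- l) a = s ^+ size l * \prod_(a <- l') a].
    by exists u, (\prod_(a <- l') a); split=> //; rewrite -sz; apply: ideal_pow_prod.
  elim: l hl => [|a l IH] hl.
    by exists 1, [::]; rewrite !big_nil; split=> //; exact: prime1.
  have [|u [l' [nu sz hl' e]]] := IH; first by move=> b bl; apply: hl; rewrite in_cons bl orbT.
  have [u' [j [nu' Jj e']]] := QJ a (hl a (mem_head _ _)).
  exists (u * u'), (j :: l'); split; first exact: primeM.
  - by rewrite /= sz.
  - by move=> b; rewrite in_cons => /orP[/eqP->|/hl'].
  - rewrite !big_cons; transitivity ((u' * a) * (u * \prod_(a <- l) a)); first by ring.
    by rewrite e e' exprS; ring.
- have h := colon_idl (s ^+ k) (ideal_pow_idl Q k).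
  suff sub j : ideal_pow J k j -> colon (ideal_pow Q k) (s ^+ k) j.
    by move=> j /sub; rewrite /colon mulrC.
  apply: ideal_pow_min => // l <- hl; rewrite /colon.
  have -> : (\prod_(a <- l) a) * s ^+ size l = \prod_(a <- [seq s * a | a <- l]) a.
    elim: l {h hl} => [|a l IH]; first by rewrite !big_nil mulr1.
    by rewrite /= !big_cons -IH exprS; ring.
  rewrite -(size_map (fun a => s * a)); apply: ideal_pow_prod => a /mapP[b bl ->].
  by apply: JQ; apply: hl.
Qed.

End Powers.

(** * Comparing Ass and depth of two powers *)

Section Main.
Variables (R : comNzRingType) (m : R -> Prop) (x y z : R).
Hypotheses (noethR : noetherian R) (pm : is_prime_ideal m).
Hypotheses (flag : prime_flag (eq^~ 0) [:: x; y; z])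
           (gen : generates m (eq^~ 0) [:: x; y; z]).
Variables (I : R -> Prop) (n : nat) (f : 'cV[R]_n).
Hypotheses (If : forall a, I a <-> exists b : 'rV_n, a = (b *m f) 0 0)
  (satf : forall i, saturated m (princ (f i 0)))
  (satI : forall k, (0 < k)%N -> saturated m (ideal_pow I k)).

Let domR : is_prime_ideal (eq^~ (0 : R)). Proof. by case: flag. Qed.

Lemma row_span_idl p (h : 'cV[R]_p) : is_ideal (fun a => exists b : 'rV_p, a = (b *m h) 0 0).
Proof.
split; first by exists 0; rewrite mul0mx mxE.
- by move=> _ _ [v ->] [w ->]; exists (v + w); rewrite mulmxDl [RHS]mxE.
- by move=> r _ [v ->]; exists (r *: v); rewrite -scalemxAl [RHS]mxE.
Qed.

Lemma row_span_in p (h : 'cV[R]_p) i : exists b : 'rV_p, h i 0 = (b *m h) 0 0.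
Proof. by exists (delta_mx 0 i); rewrite -rowE mxE. Qed.

Lemma same_ass_princ s k l P : s <> 0 -> (0 < k)%N -> (0 < l)%N ->
  (forall a, I a <-> princ s a) -> ass_quot (ideal_pow I k) P -> ass_quot (ideal_pow I l) P.
Proof.
move=> ns k0 l0 e.
have regs r : s * r = 0 -> r = 0 by move=> h; apply: (dom_mul_eq0 domR h ns).
have eX j a : princ (s ^+ j) a <-> ideal_pow I j a.
  by rewrite -ideal_pow_princ; apply: ideal_pow_ext => b; rewrite e.
move=> /(ass_ext (fun a => iff_sym (eX k a)) (fun a => iff_refl (P a))).
move=> /(ass_princ_pow regs P k0) h.
apply: (ass_ext (eX l) (fun a => iff_refl (P a))).
exact/(ass_princ_pow regs P l0).
Qed.

Lemma same_depth_princ s k l d : s <> 0 -> (0 < k)%N ->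
  (forall a, I a <-> princ s a) ->
  depth_ge m (ideal_pow I k) d -> depth_ge m (ideal_pow I l) d.
Proof.
move=> ns k0 e.
have regs r : s * r = 0 -> r = 0 by move=> h; apply: (dom_mul_eq0 domR h ns).
have eX j a : princ (s ^+ j) a <-> ideal_pow I j a.
  by rewrite -ideal_pow_princ; apply: ideal_pow_ext => b; rewrite e.
move=> /(depth_ext (fun a => iff_sym (eX k a))) h.
by apply: (depth_ext (eX l)); apply: (depth_princ_pow regs l k0).
Qed.

Lemma principal_or_scaled : (exists s, forall a, I a <-> princ s a) \/
  exists s J, [/\ s <> 0, locally_scaled m s I J & forall j, J j -> m j].
Proof.
have [[i0 nf]|allz] := classic (exists i, f i 0 <> 0); last first.
  left; exists 0 => a; rewrite If; split=> -[b ->]; last by exists 0; rewrite mulr0 mul0mx mxE.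
  exists 0; rewrite mulr0 mxE big1 // => i _.
  have -> : f i 0 = 0 by apply: NNPP => h; apply: allz; exists i.
  by rewrite mulr0.
have [s [h [u [nu e gr]]]] := factor noethR pm domR flag gen nf.
have ei i : u * f i 0 = s * h i 0 by have /colP/(_ i) := e; rewrite [LHS]mxE [RHS]mxE.
have nu0 := notin_prime_neq0 pm nu.
(* When h_i is outside m, f_i divides h_i f_j, hence f_j by [satf]: I is principal on the nose, not
   only up to multipliers. *)
have [[i nh]|hm] := classic (exists i, ~ m (h i 0)).
  left; exists (f i 0) => a; rewrite If; split=> [|[c ->]]; last first.
    by have [b ->] := row_span_in f i; exists (c *: b); rewrite -scalemxAl [RHS]mxE.
  move=> [b ->]; rewrite mxE; apply: idl_sum; first exact: princ_idl.
  move=> j _; apply: idlM; first exact: princ_idl.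
  apply: (satf nh); exists (h j 0).
  apply: (dom_mulfI domR nu0); transitivity (h i 0 * (u * f j 0)); first by ring.
  by rewrite ei; transitivity (h j 0 * (u * f i 0)); [rewrite ei; ring|ring].
right; exists s, (fun a => exists b : 'rV_n, a = (b *m h) 0 0); split.
- move=> s0; apply: nf; apply: (dom_mul_eq0 domR _ nu0).
  by rewrite ei s0 mul0r.
- have ub (b : 'rV_n) : u * (b *m f) 0 0 = s * (b *m h) 0 0.
    have /matrixP/(_ 0 0) : u *: (b *m f) = s *: (b *m h) by rewrite !scalemxAr e.
    by rewrite [LHS]mxE [RHS]mxE.
  split.
  + have [h1 h2 h3] := row_span_idl f; split; first exact/If.
      by move=> a b /If ha /If hb; apply/If; apply: h2.
    by move=> r a /If ha; apply/If; apply: h3.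
  + exact: row_span_idl.
  + move=> _ /If[b ->]; exists u, ((b *m h) 0 0); split=> //; by exists b.
  + move=> _ [b ->]; rewrite -ub; apply/If; exists (u *: b).
    by rewrite -scalemxAl [RHS]mxE.
  + move=> c t nc hc; apply: gr => // _ [i ->]; apply: hc; exact: row_span_in.
- move=> _ [b ->]; rewrite mxE; apply: idl_sum; first exact: prime_idl.
  move=> i _; apply: idlM; first exact: prime_idl.
  by apply: NNPP => nm; apply: hm; exists i.
Qed.

Lemma ass_iff_depth k l : (0 < k)%N -> (0 < l)%N ->
  (forall P, ass_quot (ideal_pow I k) P <-> ass_quot (ideal_pow I l) P) <->
  (forall d, depth_ge m (ideal_pow I k) d <-> depth_ge m (ideal_pow I l) d).
Proof.
move=> k0 l0.
have [[s e]|[s [J [ns sc Jm]]]] := principal_or_scaled; first have [s0|ns] := classic (s = 0).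
(* For s = 0 all positive powers are the zero ideal; the results on principal powers require a
   regular s. *)
- have eX j : (0 < j)%N -> forall a, ideal_pow I j a <-> princ 0 a.
    move=> j0 a; have z0 : 0 ^+ j = 0 :> R by rewrite expr0n; case: j j0.
    have h := ideal_pow_princ 0 j a; rewrite z0 in h; rewrite -h.
    by apply: ideal_pow_ext => b; rewrite e s0.
  have ekl a : ideal_pow I k a <-> ideal_pow I l a by rewrite (eX k k0) (eX l l0).
  split=> _ => [d|P]; split.
  + exact: depth_ext.
  + by apply: depth_ext => a; rewrite ekl.
  + exact: (ass_ext ekl (fun=> iff_refl _)).
  + exact: (ass_ext (fun a => iff_sym (ekl a)) (fun=> iff_refl _)).
- split=> _ => [d|P]; split.
  + exact: (same_depth_princ _ ns k0 e).
  + exact: (same_depth_princ _ ns l0 e).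
  + exact: (same_ass_princ ns k0 l0 e).
  + exact: (same_ass_princ ns l0 k0 e).
have ns' j : s ^+ j <> 0.
  elim: j => [|j IH]; first by rewrite expr0; apply/eqP; rewrite oner_eq0.
  by rewrite exprS => /(dom_mul_eq0 domR)/(_ ns).
have sc' j := locally_scaled_pow pm j sc.
have iI j := ideal_pow_idl I j.
have assD j (j0 : (0 < j)%N) := depth_ge1 noethR pm (iI j) (satI j0).
have regs r : s * r = 0 -> r = 0 by move=> h; apply: (dom_mul_eq0 domR h ns).
split.
  move=> hass [|[|d]]; first by split=> _; apply: depth_ge0.
    by rewrite (assD k k0) (assD l l0) hass.
  have nd j : (0 < j)%N -> ~ depth_ge m (ideal_pow I j) d.+2.
    move=> j0; apply: (depth_lt2 noethR pm flag gen (ns' j) (sc' j) (satI j0)).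
    exact/(ideal_pow_prime _ pm j0).
  by split=> /nd; case.
move=> hd.
have hm : ass_quot (ideal_pow I k) m <-> ass_quot (ideal_pow I l) m.
  have := hd 1%N; rewrite (assD k k0) (assD l l0) => h.
  by split=> a; apply: NNPP => na; have := proj1 h; have := proj2 h; tauto.
have half j j' P : (0 < j)%N -> (0 < j')%N ->
    (ass_quot (ideal_pow I j) m -> ass_quot (ideal_pow I j') m) ->
    ass_quot (ideal_pow I j) P -> ass_quot (ideal_pow I j') P.
  move=> j0 j0' hmm assP; have [pP [w hw]] := assP.
  have [ex|no] := classic (exists r, m r /\ ~ P r).
    move: assP.
    rewrite (ass_locally_scaled noethR pm flag gen (ns' j) (sc' j) (satI j0) pP ex).
    rewrite (ass_locally_scaled noethR pm flag gen (ns' j') (sc' j') (satI j0') pP ex).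
    rewrite !(ass_princ_pow regs) //.
    by rewrite (ideal_pow_prime _ pP j0) (ideal_pow_prime _ pP j0').
  have Pm r : P r <-> m r.
    split=> [Pr|mr]; apply: NNPP => nr; last by apply: no; exists r.
    apply: (prime1 pP); apply/hw; rewrite /colon mul1r.
    by apply: (satI j0 nr); apply/hw.
  apply: (ass_ext (fun=> iff_refl _) (fun r => iff_sym (Pm r))); apply: hmm.
  exact: (ass_ext (fun=> iff_refl _) Pm).
by move=> P; split; apply: half => //; case: hm.
Qed.

Lemma astab_iff_dstab k0 : is_astab I k0 <-> is_dstab m I k0.
Proof.
have st k : (0 < k)%N -> ass_stable_from I k <-> depth_stable_from m I k.
  by move=> kp; split=> h l le; apply/(ass_iff_depth _ kp); [exact: leq_trans le|exact: h
    |exact: leq_trans le|exact: h].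
split=> -[kp hk hmin]; split=> //; try exact/st.
- by move=> k kp' hk'; apply: hmin => //; apply/st.
- by move=> k kp' hk'; apply: hmin => //; apply/st.
Qed.

End Main.

(** * Regular local rings *)

Section ThreeGenerators.
Variable R : comNzRingType.
Implicit Types (I J m : R -> Prop).

Lemma maximal_prime m : is_maximal_ideal m -> is_prime_ideal m.
Proof.
move=> [im nm1 maxm]; split=> // a b mab; have [|na] := classic (m a); [by left|right].
have [h|[r hr]] := maxm (add1 m a) (add1_idl a im) (fun c => @add1_sub R m a c).
  by case: na; apply/h/add1_in.
have -> : b = b * (1 - r * a) + r * (a * b) by ring.
by apply: idlD => //; apply: idlM.
Qed.

(** Elements outside m are units: a proper ideal (u) lies in a maximal ideal, found by the
    Noetherian condition, and that ideal can only be m. *)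
Lemma local_saturated m I :
  noetherian R -> local_with m -> is_ideal I -> saturated m I.
Proof.
move=> nR [maxm locm] iI u r nu Iur.
suff [v e] : princ u 1 by rewrite -[r]mul1r e -mulrA; apply: idlM.
apply: NNPP => nu1.
have [||M [iM uM nM1] maxM] := @noeth_maximal R R^o _
   (fun M : R -> Prop => [/\ is_ideal M, forall a, princ u a -> M a & ~ M 1]) id (princ u)
   (noeth_reg nR).
- by split=> //; apply: princ_idl.
- by move=> M [].
apply: nu; apply/(locm M); last by apply: uM; exists 1; rewrite mul1r.
split=> // J iJ MJ; have [|nJ1] := classic (J 1); [by right|left=> a].
split; last exact: MJ.
by apply: (maxM J) => //; split=> // b /uM /MJ.
Qed.

Lemma flag_pad J ys k : prime_flag J ys -> prime_flag J (ys ++ nseq k 0).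
Proof.
elim: ys J => [J [pJ _]|y ys IH J [pJ h]] /=; last by split=> //; apply: IH.
elim: k J pJ => [|k IHk] J pJ //=; split=> //; apply: IHk; apply: prime_ext pJ => a.
split; first exact: add1_sub.
by move=> [r]; rewrite mulr0 subr0.
Qed.

Lemma generates_pad m J ys k : is_ideal m ->
  generates m J ys -> generates m J (ys ++ nseq k 0).
Proof.
move=> im [h1 h2 h3]; split=> //.
  by move=> a; rewrite mem_cat => /orP[/h2//|/nseqP[-> _]]; apply: idl0.
move=> K iK JK sK; apply: h3 => // a ays; apply: sK.
by rewrite mem_cat ays.
Qed.

Lemma flag_three m ys : (size ys <= 3)%N -> is_ideal m ->
  prime_flag (eq^~ 0) ys -> generates m (eq^~ 0) ys ->
  exists x y z, prime_flag (eq^~ 0) [:: x; y; z] /\ generates m (eq^~ 0) [:: x; y; z].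
Proof.
move=> sz im /(flag_pad (3 - size ys)) fl /(generates_pad (3 - size ys) im).
have : size (ys ++ nseq (3 - size ys) 0) = 3%N by rewrite size_cat size_nseq subnKC.
case: (_ ++ _) fl => [|x [|y [|z [|? ?]]]] // fl _ gen.
by exists x, y, z.
Qed.

Lemma span_generates m s : (forall a, m a <-> span_seq s a) -> generates m (eq^~ 0) s.
Proof.
have iS : is_ideal (span_seq s) by apply: gen_ideal_idl.
move=> e; split.
- by move=> _ ->; apply/e; apply: idl0.
- by move=> a as_; apply/e; apply: gen_ideal_in.
- by move=> J iJ _ sJ a /e; apply: gen_ideal_sub.
Qed.

Lemma span_col s (a : R) :
  span_seq s a <-> exists b : 'rV_(size s), a = (b *m \col_i s`_i) 0 0.
Proof.
split.
  apply: (gen_ideal_sub (row_span_idl (\col_i s`_i))).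
  move=> b /(nthP 0)[i lt <-]; have [c e] := row_span_in (\col_i s`_i) (Ordinal lt).
  by exists c; rewrite -e mxE.
move=> [b ->]; rewrite mxE; apply: idl_sum; first exact: gen_ideal_idl.
move=> i _; apply: idlM; first exact: gen_ideal_idl.
by rewrite mxE; apply: gen_ideal_in; apply: mem_nth.
Qed.

Lemma astab_iff_dstab_span m ys I s k0 : noetherian R -> is_prime_ideal m ->
  (size ys <= 3)%N -> prime_flag (eq^~ 0) ys -> generates m (eq^~ 0) ys ->
  (forall a, I a <-> span_seq s a) -> (forall a, a \in s -> saturated m (princ a)) ->
  (forall k, (0 < k)%N -> saturated m (ideal_pow I k)) ->
  is_astab I k0 <-> is_dstab m I k0.
Proof.
move=> nR pm sz fl ge Is satp satI.
have [x [y [z [flag gen]]]] := flag_three sz (prime_idl pm) fl ge.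
apply: (@astab_iff_dstab R m x y z nR pm flag gen I (size s) (\col_i s`_i)) => //.
  by move=> a; rewrite Is span_col.
by move=> i; rewrite mxE; apply: satp; apply: mem_nth.
Qed.

Lemma regular_local_case m d I k0 : regular_local_dim m d -> (d <= 3)%N -> is_ideal I ->
  is_astab I k0 <-> is_dstab m I k0.
Proof.
move=> [nR locm [[C hC] dimR] [xs [szxs mxs]]] d3 iI.
have pm : is_prime_ideal m by apply: maximal_prime; case: locm.
have sat J : is_ideal J -> saturated m J by apply: local_saturated.
(* A chain of maximal length ends in m, since otherwise m could be appended to it. *)
have top a : C d a <-> m a.
  have pC : is_prime_ideal (C d) by case: hC => + _; apply.
  have Cm b : C d b -> m b.
    move=> Cb; apply: NNPP => nb; apply: (prime1 pC); apply: (sat _ (prime_idl pC) _ _ nb).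
    by rewrite mulr1.
  split=> [/Cm//|ma]; apply: NNPP => nC.
  have /dimR : prime_chain d.+1 (fun i => if (i <= d)%N then C i else m).
    by apply: chain_append => //; exists a.
  by rewrite ltnn.
have zi : is_ideal (eq^~ (0 : R)).
  by split=> // [a b -> ->|r a ->]; rewrite ?addr0 ?mulr0.
have [|||_ [ys [szys gen flag]]] :=
    @regular_flag _ nR m (eq^~ 0) xs C pm sat zi (span_generates mxs).
- by rewrite szxs.
- by move=> a ->; apply: idl0; apply: prime_idl; case: hC => + _; apply.
- by rewrite szxs.
have [s hs] := nR _ iI.
apply: (astab_iff_dstab_span (ys := ys) (s := s)) => //; first by rewrite szys szxs.
- by move=> a _; apply: sat; apply: princ_idl.
- by move=> k _; apply: sat; apply: ideal_pow_idl.
Qed.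

End ThreeGenerators.

(** * Polynomial rings *)

(** Dickson's lemma, with domination required only in the first k coordinates to allow induction on
    k. *)
Lemma dickson n (A : 'X_{1..n} -> Prop) k : exists s : seq 'X_{1..n},
  (forall a, a \in s -> A a) /\
  forall a, A a -> exists2 b, b \in s & forall j : 'I_n, (j < k)%N -> (b j <= a j)%N.
Proof.
elim: k A => [|k IH] A.
  have [[a Aa]|no] := classic (exists a, A a); last by exists [::]; split=> // a Aa; case: no; exists a.
  exists [:: a]; split; first by move=> b; rewrite inE => /eqP->.
  by move=> b _; exists a; rewrite ?mem_head.
have [s [sA hs]] := IH A.
have [nk|kn] := leqP n k.
  exists s; split=> // a /hs[b bs hb]; exists b => // j _; apply: hb.
  exact: leq_trans (ltn_ord j) nk.
pose i0 := Ordinal kn.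
have slices K : exists t : seq 'X_{1..n}, (forall a, a \in t -> A a) /\
    forall a, A a -> (a i0 < K)%N ->
      exists2 b, b \in t & forall j : 'I_n, (j < k.+1)%N -> (b j <= a j)%N.
  elim: K => [|K [t [tA ht]]]; first by exists [::].
  have [t' [t'A ht']] := IH (fun a => A a /\ a i0 = K).
  exists (t' ++ t); split; first by move=> a; rewrite mem_cat => /orP[/t'A[]|/tA].
  move=> a Aa; rewrite ltnS leq_eqVlt => /orP[/eqP aK|aK].
    have [b bt hb] := ht' a (conj Aa aK); exists b; first by rewrite mem_cat bt.
    move=> j; rewrite ltnS leq_eqVlt => /orP[/eqP jk|]; last exact: hb.
    have -> : j = i0 by apply/val_inj.
    by have [_ ->] := t'A b bt; rewrite aK.
  by have [b bt hb] := ht a Aa aK; exists b; rewrite // mem_cat bt orbT.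
(* Above this bound the next coordinate of a exceeds that of every b in s, so s suffices; below it
   only finitely many slices remain. *)
have [t [tA ht]] := slices (\max_(b <- s) b i0).+1.
exists (s ++ t); split; first by move=> a; rewrite mem_cat => /orP[/sA|/tA].
move=> a Aa; have [lt|le] := ltnP (a i0) (\max_(b <- s) b i0).+1.
  by have [b bt hb] := ht a Aa lt; exists b; rewrite // mem_cat bt orbT.
have [b bs hb] := hs a Aa; exists b; first by rewrite mem_cat bs.
move=> j; rewrite ltnS leq_eqVlt => /orP[/eqP jk|]; last exact: hb.
have -> : j = i0 by apply/val_inj.
by apply: leq_trans (ltnW le); apply: (leq_bigmax_seq (F := fun b : 'X_{1..n} => b i0)).
Qed.

Section Polynomials.
Variables (K : fieldType) (n : nat).
Implicit Types (p q r : {mpoly K[n]}) (I J : {mpoly K[n]} -> Prop).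

(** Hilbert's basis theorem by division: Dickson's lemma selects finitely many leading monomials,
    and subtracting a multiple of a selected polynomial with the same leading term lowers the
    leading monomial. *)
Lemma mpoly_noetherian : noetherian {mpoly K[n]}.
Proof.
move=> I iI.
have [s [sA hs]] := dickson (fun a => exists p, [/\ I p, p != 0 & mlead p = a]) n.
have [ps [psI psA]] : exists ps : seq {mpoly K[n]},
    (forall p, p \in ps -> I p) /\
    forall a, a \in s -> exists p, [/\ p \in ps, p != 0 & mlead p = a].
  elim: s sA {hs} => [|a s IH] sA; first by exists [::].
  have [p [Ip np ea]] := sA a (mem_head _ _).
  have [|ps [h1 h2]] := IH; first by move=> b bs; apply: sA; rewrite in_cons bs orbT.
  exists (p :: ps); split; first by move=> q; rewrite in_cons => /orP[/eqP->|/h1].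
  move=> b; rewrite in_cons => /orP[/eqP->|/h2[q [qps nq eb]]].
    by exists p; rewrite mem_head.
  by exists q; rewrite in_cons qps orbT.
exists ps => p; split; last by apply: gen_ideal_sub.
have iS : is_ideal (span_seq ps) by apply: gen_ideal_idl.
elim/mleadrect: p => p IH Ip.
have [->|np] := eqVneq p 0; first exact: idl0.
have [b /psA[q [qps nq eb]] hb] := hs (mlead p) (ex_intro _ p (And3 Ip np erefl)).
have le : (mlead q <= mlead p)%MM by apply/mnm_lepP => j; rewrite eb; apply: hb.
have lq : mleadc q != 0 by rewrite mleadc_eq0.
have lp : mleadc p != 0 by rewrite mleadc_eq0.
pose c : {mpoly K[n]} := (mleadc p / mleadc q) *: 'X_[mlead p - mlead q].
have nc : c != 0.
  apply/eqP => /(congr1 (mcoeff (mlead p - mlead q)%MM)) /eqP.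
  by rewrite mcoeffZ mcoeffX eqxx mulr1 mcoeff0; apply/negP; rewrite mulf_neq0 // invr_eq0.
have lc : mlead c = (mlead p - mlead q)%MM by rewrite mleadZ ?mleadXm // mulf_neq0 ?invr_eq0.
have lpE : mlead p = (mlead c + mlead q)%MM by rewrite lc submK.
have lcq : mlead (c * q) = mlead p by rewrite mleadM // lc submK.
have -> : p = (p - c * q) + c * q by rewrite subrK.
apply: idlD => //; last by apply: idlM => //; apply: gen_ideal_in.
have [->|nr] := eqVneq (p - c * q) 0; first exact: idl0.
apply: IH; last first.
  by apply: idlB => //; apply: idlM => //; apply: psI.
rewrite Order.POrderTheory.lt_neqAle; apply/andP; split; last first.
  by have := mleadB_le p (c * q); rewrite lcq Order.JoinTheory.joinxx.
apply: contra nr => /eqP e; rewrite -mleadc_eq0 e mcoeffB [X in _ - _@_X]lpE mleadcM lc.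
by rewrite /c mcoeffZ mcoeffX eqxx mulr1 divfK // subrr.
Qed.

Let xs : seq {mpoly K[n]} := [seq 'X_i | i <- enum 'I_n].

Lemma var_in_take k (i : 'I_n) : (i < k)%N -> 'X_i \in take k xs.
Proof.
move=> ik; rewrite -map_take; apply: map_f.
by rewrite in_take ?mem_enum // index_enum_ord.
Qed.

Lemma take_varP k p : p \in take k xs -> exists2 i : 'I_n, (i < k)%N & p = 'X_i.
Proof.
rewrite -map_take => /mapP[i + ->]; rewrite in_take ?mem_enum // index_enum_ord.
by exists i.
Qed.

(* The ideal of the first k variables is the kernel of their evaluation at 0. *)
Lemma span_vars_prime k : is_prime_ideal (span_seq (take k xs)).
Proof.
pose lq : n.-tuple {mpoly K[n]} := [tuple (if (i < k)%N then 0 else 'X_i) | i < n].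
have iS : is_ideal (span_seq (take k xs)) by apply: gen_ideal_idl.
have congM a b c d : span_seq (take k xs) (a - b) -> span_seq (take k xs) (c - d) ->
    span_seq (take k xs) (a * c - b * d).
  move=> h1 h2; have -> : a * c - b * d = c * (a - b) + b * (c - d) by ring.
  by apply: idlD => //; apply: idlM.
have congX p : span_seq (take k xs) (p - (p \mPo lq)).
  elim/mpolyind: p => [|c a p _ _ IH]; first by rewrite comp_mpoly0 subrr; apply: idl0.
  rewrite comp_mpolyD comp_mpolyZ opprD addrACA -scalerBr.
  apply: idlD => //; rewrite -mul_mpolyC; apply: idlM => //.
  rewrite comp_mpolyX mpolyXE_id.
  apply: (big_ind2 (fun u v => span_seq (take k xs) (u - v))).
  - by rewrite subrr; apply: idl0.
  - by move=> *; apply: congM.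
  - move=> i _; elim: (a i) => [|e IHe]; first by rewrite subrr; apply: idl0.
    rewrite !exprS; apply: congM => //; rewrite tnth_mktuple.
    case: ifP => ik; last by rewrite subrr; apply: idl0.
    by rewrite subr0; apply: gen_ideal_in; apply: var_in_take.
have ker p : span_seq (take k xs) p <-> p \mPo lq = 0.
  split; last by move=> e; rewrite -[p]subr0 -e.
  have iK : is_ideal (fun p => p \mPo lq = 0).
    split; first exact: comp_mpoly0.
    - by move=> a b ha hb; rewrite comp_mpolyD ha hb addr0.
    - by move=> a b hb; rewrite rmorphM /= hb mulr0.
  apply: (gen_ideal_sub iK) => _ /take_varP[i ik ->].
  by rewrite comp_mpolyXU -tnth_nth tnth_mktuple ik.
split=> //.
  by move=> /ker; rewrite comp_mpoly1 => /eqP; rewrite oner_eq0.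
move=> a b /ker; rewrite rmorphM /= => /eqP; rewrite mulf_eq0.
by move=> /orP[/eqP|/eqP] h; [left|right]; apply/ker.
Qed.

Lemma graded_max_prime : is_prime_ideal (@graded_max K n).
Proof.
have := span_vars_prime n; rewrite take_oversize //.
by rewrite size_map size_enum_ord.
Qed.

Lemma graded_max_coef0 p : p@_0 = 0 -> graded_max p.
Proof.
have iS : is_ideal (@graded_max K n) by apply: gen_ideal_idl.
move=> p0; rewrite [p]mpolyE; apply: idl_sum => // a _.
have [->|na] := eqVneq a 0%MM; first by rewrite p0 scale0r; apply: idl0.
have [i hi] : exists i, (0 < a i)%N.
  apply: NNPP => no; case/eqP: na; apply/mnmP => i; rewrite mnm0E.
  by case e: (a i) => [//|e']; case: no; exists i; rewrite e.
have le : (U_(i) <= a)%MM by rewrite lep1mP -lt0n.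
rewrite -mul_mpolyC -(submK le) mpolyXD mulrA; apply: idlM => //.
by apply: gen_ideal_in; apply: map_f; rewrite mem_enum.
Qed.

Lemma hcompE d p : hcomp d p = pihomog mdeg d p.
Proof. by []. Qed.

Lemma hcomp_homog d e p : hcomp d (hcomp e p) = if d == e then hcomp e p else 0.
Proof.
case: eqP => [->|/eqP ne]; rewrite !hcompE; first by rewrite pihomog_id.
by rewrite (pihomog_ne0 (d := e)) //; [rewrite eq_sym|exact: pihomogP].
Qed.

Lemma hcompM d k p q : (msize p <= k)%N -> (msize q <= k)%N ->
  hcomp d (p * q) = \sum_(i < k) \sum_(j < k | (i + j == d)%N) hcomp i p * hcomp j q.
Proof.
move=> hp hq; rewrite {1}(pihomog_partitionE (mf := mdeg) hp).
rewrite {1}(pihomog_partitionE (mf := mdeg) hq) hcompE big_distrl linear_sum.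
apply: eq_bigr => i _; rewrite big_distrr linear_sum [RHS]big_mkcond.
apply: eq_bigr => j _ /=.
have h : pihomog mdeg i p * pihomog mdeg j q \is (i + j).-homog.
  by apply: dhomogM; apply: pihomogP.
case: eqP => [<-|/eqP ne]; first by rewrite pihomog_dE.
by rewrite (pihomog_ne0 (d := (i + j)%N)).
Qed.

Lemma hcomp0 p : hcomp 0 p = (p@_0)%:MP.
Proof.
rewrite /hcomp (eq_bigl (fun a : 'X_{1..n} => a == 0%MM)); last by move=> a; rewrite mdeg_eq0.
have [h|h] := boolP (0%MM \in msupp p).
  rewrite big_mkcond (bigD1_seq 0%MM) //= ?msupp_uniq // eqxx big1 ?addr0; last first.
    by move=> a /negbTE ->.
  by rewrite mpolyX0 -mul_mpolyC mulr1.
rewrite (memN_msupp_eq0 h) mpolyC0 big_seq_cond big1 // => a /andP[as_ /eqP e].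
by rewrite e (negbTE h) in as_.
Qed.

Definition closed_hcomp I := forall p d, I p -> I (hcomp d p).

(** For an ideal, containment in this ideal can be tested on generators, which is how products and
    powers are shown to be graded. *)
Lemma hcomp_idl I : is_ideal I -> is_ideal (fun p => forall d, I (hcomp d p)).
Proof.
move=> iI; split.
- by move=> d; rewrite hcompE pihomog0; apply: idl0.
- by move=> p q hp hq d; rewrite hcompE pihomogD; apply: (idlD iI (hp d) (hq d)).
- move=> r p hp d; rewrite (hcompM d (k := maxn (msize r) (msize p))) ?leq_maxl ?leq_maxr //.
  apply: (big_ind I); [exact: idl0|by move=> a b; apply: idlD|move=> i _].
  apply: (big_ind I); [exact: idl0|by move=> a b; apply: idlD|move=> j _].
  exact: idlM.
Qed.

(** Here gradedness replaces locality. Since u has a nonzero constant term u_0, the degree d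
    component of u r is u_0 r_d plus multiples of lower components of r, which are in I by
    induction. *)
Lemma graded_saturated I : is_ideal I -> closed_hcomp I -> saturated (@graded_max K n) I.
Proof.
move=> iI gI u r nu Iur.
have nu0 : u@_0 != 0 by apply/eqP => /graded_max_coef0.
have hr d : I (hcomp d r).
  elim/ltn_ind: d => d IH.
  (* The bound exceeds d as well as both sizes, so that degree d occurs among the indices of the
     double sum. *)
  pose k := (maxn (msize u) (msize r) + d.+1)%N.
  have ku : (msize u <= k)%N by rewrite (leq_trans (leq_maxl _ (msize r))) ?leq_addr.
  have kr : (msize r <= k)%N by rewrite (leq_trans (leq_maxr (msize u) _)) ?leq_addr.
  have k0 : (0 < k)%N by rewrite /k addnS.
  have kd : (d < k)%N by rewrite /k leq_addl.
  have : I (hcomp 0 u * hcomp d r).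
    have -> : hcomp 0 u * hcomp d r = hcomp d (u * r) -
        (hcomp d (u * r) - hcomp 0 u * hcomp d r) by rewrite subKr.
    apply: idlB => //; first exact: gI.
    rewrite (hcompM d ku kr) (bigD1 (Ordinal k0)) //= (bigD1 (Ordinal kd)) //=.
    rewrite addrAC [X in X - _]addrC addrK; apply: idlD => //.
      rewrite big1; first exact: idl0.
      by move=> j; rewrite add0n -(inj_eq val_inj) /= => /andP[->].
    apply: (big_ind I); [exact: idl0|by move=> a b; apply: idlD|move=> i ni].
    apply: (big_ind I); [exact: idl0|by move=> a b; apply: idlD|move=> j /eqP ij].
    apply: idlM => //; apply: IH; rewrite -ij -[X in (X < _)%N]add0n ltn_add2r lt0n.
    by rewrite -(inj_eq val_inj) in ni.
  rewrite hcomp0 => h.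
  have -> : hcomp d r = (u@_0)^-1%:MP * ((u@_0)%:MP * hcomp d r).
    by rewrite mulrA -mpolyCM mulVf // mul1r.
  exact: idlM.
rewrite (pihomog_partitionE (mf := mdeg) (leqnn (msize r))).
by apply: (big_ind I); [exact: idl0|by move=> a b; apply: idlD|move=> i _; apply: hr].
Qed.

Lemma ideal_pow_mul I k p q : I p -> ideal_pow I k q -> ideal_pow I k.+1 (p * q).
Proof.
move=> Ip; have iK := colon_idl p (ideal_pow_idl I k.+1).
rewrite mulrC; apply: (ideal_pow_min iK) => l <- hl; rewrite /colon mulrC -(big_cons _ _ p l xpredT id).
by apply: (@ideal_pow_prod _ I (p :: l)) => a; rewrite in_cons => /orP[/eqP->|/hl].
Qed.

Lemma closed_hcomp_pow I k : closed_hcomp I -> closed_hcomp (ideal_pow I k).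
Proof.
move=> gI p d Ip; move: p Ip d; apply: ideal_pow_min.
  exact/hcomp_idl/ideal_pow_idl.
move=> l <-; elim: l {k} => [|a l IH] hl d.
  have i0 := ideal_pow_idl I 0; rewrite -[hcomp _ _]mulr1; apply: idlM => //.
  by have := @ideal_pow_prod _ I [::]; rewrite big_nil; apply.
have iS := ideal_pow_idl I (size (a :: l)).
rewrite big_cons (hcompM d (k := maxn (msize a) (msize (\prod_(b <- l) b)))) ?leq_maxl ?leq_maxr //.
apply: (big_ind (ideal_pow I (size (a :: l)))); [exact: idl0|by move=> ? ?; apply: idlD|move=> i _].
apply: (big_ind (ideal_pow I (size (a :: l)))); [exact: idl0|by move=> ? ?; apply: idlD|move=> j _].
apply: ideal_pow_mul; first by apply: gI; apply: hl; rewrite mem_head.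
by apply: IH => b bl; apply: hl; rewrite in_cons bl orbT.
Qed.

Lemma princ_hcomp_closed e p : closed_hcomp (princ (hcomp e p)).
Proof.
move=> _ d [r ->]; have iP := princ_idl (hcomp e p).
have := hcomp_idl iP => /idlM; apply => {}d; rewrite hcomp_homog.
by case: eqP => _; [exists 1; rewrite mul1r|exact: idl0].
Qed.

Lemma prime_flag_spans (R : comNzRingType) (J : R -> Prop) pre ys :
  (forall k, is_prime_ideal (span_seq (pre ++ take k ys))) ->
  (forall a, span_seq pre a <-> J a) -> prime_flag J ys.
Proof.
elim: ys pre J => [|y ys IH] pre J h e /=.
  by split=> //; apply: (prime_ext e); have := h 0%N; rewrite cats0.
split; first by apply: (prime_ext e); have := h 0%N; rewrite take0 cats0.
apply: (IH (rcons pre y)); first by move=> k; have := h k.+1; rewrite cat_rcons.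
by move=> a; rewrite span_seq_rcons; split=> -[r hr]; exists r; apply/e.
Qed.

Lemma graded_case I k0 : (n <= 3)%N -> graded_ideal I ->
  is_astab I k0 <-> is_dstab (@graded_max K n) I k0.
Proof.
move=> n3 [iI gI]; have [s hs] := mpoly_noetherian iI.
(* Homogeneous generators make every principal ideal (f_i) graded, hence saturated with respect to
   the graded maximal ideal. *)
pose t := [seq hcomp d p | p <- s, d <- iota 0 (msize p)].
have iS u : is_ideal (@span_seq {mpoly K[n]} u) by apply: gen_ideal_idl.
have It p : I p <-> span_seq t p.
  rewrite hs; split.
    apply: gen_ideal_sub => // q qs.
    rewrite (pihomog_partitionE (mf := mdeg) (leqnn (msize q))).
    apply: (big_ind (span_seq t)); [exact: idl0|by move=> a b; apply: idlD|move=> i _].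
    apply: gen_ideal_in; apply/allpairsPdep; exists q, (val i).
    by rewrite mem_iota add0n ltn_ord.
  apply: gen_ideal_sub => // _ /allpairsPdep[q [d [qs _ ->]]].
  by apply/hs; apply: gI; apply/hs; apply: gen_ideal_in.
apply: (@astab_iff_dstab_span _ _ xs _ t) => //.
- exact: mpoly_noetherian.
- exact: graded_max_prime.
- by rewrite size_map size_enum_ord.
- apply: (prime_flag_spans (pre := [::])) => [k|a]; first exact: span_vars_prime.
  exact: span_seq_nil.
- by apply: (@span_generates {mpoly K[n]}) => a.
- move=> _ /allpairsPdep[q [d [_ _ ->]]].
  by apply: graded_saturated; [exact: princ_idl|exact: princ_hcomp_closed].
- by move=> k _; apply: graded_saturated; [exact: ideal_pow_idl|exact: closed_hcomp_pow].
Qed.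

End Polynomials.

Theorem theorem1p2 :
  (forall (R : comNzRingType) (m : R -> Prop) (d : nat) (I : R -> Prop),
     regular_local_dim m d -> (d <= 3)%N -> is_ideal I ->
     forall k0 : nat, is_astab I k0 <-> is_dstab m I k0) /\
  (forall (K : fieldType) (n : nat) (I : {mpoly K[n]} -> Prop),
     (n <= 3)%N -> graded_ideal I ->
     forall k0 : nat, is_astab I k0 <-> is_dstab (@graded_max K n) I k0).
Proof.
split=> [R m d I reg d3 iI|K n I n3 gI] k0; first exact: regular_local_case reg d3 iI.
exact: graded_case.
Qed.
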